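(* Let $\mathbb{G}$ be a two step stratified group equipped with a homogeneous distance $\rho$, let $\Sigma\subset\mathbb{G}$ be a $C^{1,1}$ submanifold of degree $d$, and let $\delta$ be a positive integer. Then the subset $$Z_\delta=\{x\in\Sigma\mid d_\Sigma(x)\leq\delta\}$$ is countably $\mathcal{H}^\delta$-finite. In particular, its Hausdorff dimension (with respect to $\rho$) is less than or equal to $\delta$.
   Context: A two step stratified group $\mathbb{G}$ is a connected, simply connected, finite dimensional real Lie group whose Lie algebra $\mathcal{G}$ is a direct sum $\mathcal{G}=V_1\oplus V_2$ of nonzero subspaces with $[V_1,V_1]=V_2$ and $[V_1,V_2]=[V_2,V_2]=\{0\}$. The exponential map $\exp:\mathcal{G}\to\mathbb{G}$ is an analytic diffeomorphism. For $r>0$ the dilation $\delta_r:\mathcal{G}\to\mathcal{G}$ is $\delta_r(v_1+v_2)=rv_1+r^2v_2$ for $v_j\in V_j$; the same symbol denotes the induced map $\exp\circ\,\delta_r\circ\exp^{-1}$ on $\mathbb{G}$. A homogeneous distance on $\mathbb{G}$ is a continuous distance $\rho:\mathbb{G}\times\mathbb{G}\to\mathbb{R}$ such that $\rho(ux,uy)=\rho(x,y)$ for all $u,x,y\in\mathbb{G}$ and $\rho(\delta_rx,\delta_ry)=r\,\rho(x,y)$ for all $x,y\in\mathbb{G}$, $r>0$. $\mathcal{H}^\delta$ is the $\delta$-dimensional Hausdorff measure with respect to $\rho$; a set is countably $\mathcal{H}^\delta$-finite if it is a countable union of sets of finite $\mathcal{H}^\delta$ measure. Degree: let $q=\dim\mathcal{G}$,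 fix a graded metric (a left invariant Riemannian metric for which $V_1$ and $V_2$ are orthogonal), and let $(W_1,\dots,W_q)$ be an orthonormal basis of $\mathcal{G}$ such that $(W_1,\dots,W_{m_1})$ is a basis of $V_1$ and $(W_{m_1+1},\dots,W_q)$ is a basis of $V_2$, where $m_1=\dim V_1$. Set $d_i=1$ if $W_i\in V_1$ and $d_i=2$ if $W_i\in V_2$. For $J=(j_1,\dots,j_p)$ with $1\le j_1<\dots<j_p\le q$ put $W_J=W_{j_1}\wedge\dots\wedge W_{j_p}$ and $d_J=d_{j_1}+\dots+d_{j_p}$. For a nonzero simple $p$-vector $\tau=\sum_J\tau_JW_J\in\Lambda_p(\mathcal{G})$ its degree is $d(\tau)=\max\{d_J\mid\tau_J\neq0\}$. For a $p$-dimensional $C^1$ submanifold $\Sigma$ and $x\in\Sigma$, the degree of $\Sigma$ at $x$ is $d_\Sigma(x)=d(\tau_\Sigma(x))$, where $\tau_\Sigma(x)$ is any nonzero tangent $p$-vector of $\Sigma$ at $x$ (all are proportional), regarded as an element of $\Lambda_p(\mathcal{G})$ by identifying $T_x\mathbb{G}$ with $\mathcal{G}$ through left invariant vector fields. The degree of $\Sigma$ is $d(\Sigma)=\max_{x\in\Sigma}d_\Sigma(x)$. *)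

(* Defs.v *)
From HB Require Import structures.
From mathcomp Require Import all_boot all_order all_algebra.
From mathcomp Require Import all_classical all_reals all_analysis.

Set Implicit Arguments.
Unset Strict Implicit.
Unset Printing Implicit Defensive.

Import Order.TTheory GRing.Theory Num.Theory.
Import numFieldNormedType.Exports.

Local Open Scope classical_set_scope.
Local Open Scope ring_scope.

(* For U of finite dimension, f is C^(k+1) iff it is differentiable and each of
   its directional derivatives is C^k. *)
Fixpoint is_Ck (R : realType) (U W : normedModType R) (k : nat) (f : U -> W)
    : Prop :=
  if k is k'.+1 then
    (forall x, differentiable f x) /\
    (forall v, is_Ck k' (fun x => 'd f x v : W))
  else continuous f.

Definition is_smooth (R : realType) (U W : normedModType R) (f : U -> W) :=
  forall k, is_Ck k f.

(* The left invariant vector field of value X at the unit element, read in the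
   coordinates log: its value at z is the differential at 0 of the left
   translation by exp z, applied to X. *)
Definition left_inv_field (R : realType) (G : groupType) (q : nat)
    (exp : 'rV[R]_q -> G) (log : G -> 'rV[R]_q) (X z : 'rV[R]_q) : 'rV[R]_q :=
  'd (fun y : 'rV[R]_q => log (exp z * exp y)%g) 0 X.

(* A Lie group whose exponential map is a diffeomorphism, which covers every
   connected and simply connected nilpotent Lie group. A linear basis of the Lie
   algebra identifies it with 'rV[R]_q; log is then a global chart. No
   Baker-Campbell-Hausdorff formula is assumed.
   - lg_oneparam: exp is the exponential map, i.e. t |-> exp (t X) is the
     one-parameter subgroup whose velocity at the unit element is X;
   - lg_bracketP: the bracket of the Lie algebra is the commutator
     [X, Y] = DY.X - DX.Y of left invariant vector fields. *)
Record expLieGroup (R : realType) := ExpLieGroup {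
  lg_sort :> groupType;
  lg_dim : nat;
  lg_exp : 'rV[R]_lg_dim -> lg_sort;
  lg_log : lg_sort -> 'rV[R]_lg_dim;
  lg_expK : cancel lg_exp lg_log;
  lg_logK : cancel lg_log lg_exp;
  lg_mul_smooth : is_smooth (fun z : 'rV[R]_lg_dim * 'rV[R]_lg_dim =>
    lg_log (lg_exp z.1 * lg_exp z.2)%g);
  lg_inv_smooth : is_smooth (fun z : 'rV[R]_lg_dim =>
    lg_log ((lg_exp z)^-1)%g);
  lg_oneparam : forall (X : 'rV[R]_lg_dim) (s t : R),
    lg_exp ((s + t) *: X) = (lg_exp (s *: X) * lg_exp (t *: X))%g;
  lg_bracket : 'rV[R]_lg_dim -> 'rV[R]_lg_dim -> 'rV[R]_lg_dim;
  lg_bracketP : forall X Y z : 'rV[R]_lg_dim,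
    let LX := left_inv_field lg_exp lg_log X in
    let LY := left_inv_field lg_exp lg_log Y in
    left_inv_field lg_exp lg_log (lg_bracket X Y) z
    = 'd LY z (LX z) - 'd LX z (LY z)
}.

(* [A, B] = C, where [A, B] is the linear span of the brackets. *)
Definition bracket_span (R : realType) (G : expLieGroup R)
    (A B C : {vspace 'rV[R]_(lg_dim G)}) : Prop :=
  (forall X Y, X \in A -> Y \in B -> lg_bracket X Y \in C) /\
  (forall D : {vspace 'rV[R]_(lg_dim G)},
    (forall X Y, X \in A -> Y \in B -> lg_bracket X Y \in D) ->
    (C <= D)%VS).

Record two_step_stratified (R : realType) (G : expLieGroup R)
    (V1 V2 : {vspace 'rV[R]_(lg_dim G)}) : Prop := TwoStepStratified {
  strat_sum : (V1 + V2)%VS = fullv;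
  strat_direct : (V1 :&: V2)%VS = 0%VS;
  strat_V1_neq0 : V1 <> 0%VS;
  strat_V2_neq0 : V2 <> 0%VS;
  strat_V1V1 : bracket_span V1 V1 V2;
  strat_V1V2 : bracket_span V1 V2 0%VS;
  strat_V2V2 : bracket_span V2 V2 0%VS
}.

Definition lie_dilation (R : realType) (G : expLieGroup R)
    (V1 V2 : {vspace 'rV[R]_(lg_dim G)}) (r : R) (X : 'rV[R]_(lg_dim G))
    : 'rV[R]_(lg_dim G) :=
  r *: daddv_pi V1 V2 X + r ^+ 2 *: daddv_pi V2 V1 X.

Definition dilation (R : realType) (G : expLieGroup R)
    (V1 V2 : {vspace 'rV[R]_(lg_dim G)}) (r : R) (x : G) : G :=
  lg_exp (lie_dilation V1 V2 r (lg_log x)).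

(* The topology of G is the one transported by exp. *)
Record homogeneous_distance (R : realType) (G : expLieGroup R)
    (V1 V2 : {vspace 'rV[R]_(lg_dim G)}) (rho : G -> G -> R) : Prop :=
  HomogeneousDistance {
  hd_ge0 : forall x y, 0 <= rho x y;
  hd_eq0 : forall x y, rho x y = 0 <-> x = y;
  hd_sym : forall x y, rho x y = rho y x;
  hd_triangle : forall x y z, rho x z <= rho x y + rho y z;
  hd_continuous : continuous (fun z : 'rV[R]_(lg_dim G) * 'rV[R]_(lg_dim G) =>
    rho (lg_exp z.1) (lg_exp z.2));
  hd_left_inv : forall u x y : G, rho (u * x)%g (u * y)%g = rho x y;
  hd_homogeneous : forall (r : R) (x y : G), 0 < r ->
    rho (dilation V1 V2 r x) (dilation V1 V2 r y) = r * rho x y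
}.

(* A left invariant Riemannian metric is given by its value at the unit element,
   an inner product on the Lie algebra. *)
Record graded_metric (R : realType) (G : expLieGroup R)
    (V1 V2 : {vspace 'rV[R]_(lg_dim G)})
    (g : 'rV[R]_(lg_dim G) -> 'rV[R]_(lg_dim G) -> R)
    : Prop := GradedMetric {
  gm_linear : forall a X Y Z, g (a *: X + Y) Z = a * g X Z + g Y Z;
  gm_sym : forall X Y, g X Y = g Y X;
  gm_pos : forall X, X != 0 -> 0 < g X X;
  gm_orthogonal : forall X Y, X \in V1 -> Y \in V2 -> g X Y = 0
}.

Record graded_basis (R : realType) (G : expLieGroup R)
    (V1 V2 : {vspace 'rV[R]_(lg_dim G)})
    (g : 'rV[R]_(lg_dim G) -> 'rV[R]_(lg_dim G) -> R)
    (W : (lg_dim G).-tuple 'rV[R]_(lg_dim G)) : Prop := GradedBasis {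
  gb_orthonormal : forall i j, g (tnth W i) (tnth W j) = (i == j)%:R;
  gb_V1 : basis_of V1 (take (\dim V1) W);
  gb_V2 : basis_of V2 (drop (\dim V1) W)
}.

(* Increasing multi-indices J = (j_1 < ... < j_p) with values in 'I_q. *)
Definition multiindex (p q : nat) : finType :=
  {J : {ffun 'I_p -> 'I_q} |
    [forall i : 'I_p, forall j : 'I_p, (i < j)%N ==> (J i < J j)%N]}.

(* A p-vector is represented by its coefficients in the basis (W_J)_J of the
   p-th exterior power of the Lie algebra. *)
Definition pvector (R : realType) (q p : nat) := {ffun multiindex p q -> R}.

(* v_1 /\ ... /\ v_p: its coefficient on W_J is the minor of indices J of the
   matrix of coordinates of the v_i in the basis W. *)
Definition wedge (R : realType) (G : expLieGroup R)
    (W : (lg_dim G).-tuple 'rV[R]_(lg_dim G)) (p : nat)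
    (v : 'I_p -> 'rV[R]_(lg_dim G)) : pvector R (lg_dim G) p :=
  [ffun J : multiindex p (lg_dim G) =>
    \det (\matrix_(i < p, k < p) coord W (val J k) (v i)) : R].

Definition index_weight (R : realType) (G : expLieGroup R)
    (V1 : {vspace 'rV[R]_(lg_dim G)}) (W : (lg_dim G).-tuple 'rV[R]_(lg_dim G))
    (i : 'I_(lg_dim G)) : nat :=
  if tnth W i \in V1 then 1 else 2.

Definition pvector_degree (R : realType) (G : expLieGroup R)
    (V1 : {vspace 'rV[R]_(lg_dim G)}) (W : (lg_dim G).-tuple 'rV[R]_(lg_dim G))
    (p : nat) (tau : pvector R (lg_dim G) p) : nat :=
  \max_(J | tau J != 0) \sum_(i < p) index_weight V1 W (val J i).

Definition is_C11_on (R : realType) (p q : nat) (V : set 'rV[R]_p)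
    (phi : 'rV[R]_p -> 'rV[R]_q) : Prop :=
  (forall u, V u -> differentiable phi u) /\
  (forall u, V u -> exists2 N : set 'rV[R]_p, nbhs u N &
    [lipschitz ('J phi v) | v in N `&` V]).

(* Embedded p-dimensional submanifolds of class C^{1,1} of R^q, through local
   parametrizations: injective immersions of class C^{1,1} which are
   homeomorphisms onto relatively open subsets. *)
Definition C11_submanifold_rV (R : realType) (p q : nat) (S : set 'rV[R]_q)
    : Prop :=
  forall z, S z -> exists (V : set 'rV[R]_p) (phi : 'rV[R]_p -> 'rV[R]_q),
    [/\ open V,
        (phi @` V) z,
        is_C11_on V phi,
        (forall u, V u -> row_free ('J phi u)) &
        (forall u v, V u -> V v -> phi u = phi v -> u = v) /\
        (forall O, open O -> O `<=` V ->
          exists U : set 'rV[R]_q, open U /\ phi @` O = S `&` U)].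

Definition C11_submanifold (R : realType) (G : expLieGroup R) (p : nat)
    (Sigma : set G) : Prop :=
  C11_submanifold_rV p (@lg_exp R G @^-1` Sigma).

(* Velocities at z of the curves that lie in S. *)
Definition tangent_vector (R : realType) (q : nat) (S : set 'rV[R]_q)
    (z v : 'rV[R]_q) : Prop :=
  exists gamma : R -> 'rV[R]_q,
    [/\ gamma 0 = z,
        (\forall t \near (0 : R), S (gamma t)) &
        is_derive (0 : R) (1 : R) gamma v].

(* X in the Lie algebra is identified with the value at x of its left invariant
   vector field. *)
Definition lie_tangent (R : realType) (G : expLieGroup R) (Sigma : set G)
    (x : G) (X : 'rV[R]_(lg_dim G)) : Prop :=
  tangent_vector (@lg_exp R G @^-1` Sigma) (lg_log x)
    (left_inv_field (@lg_exp R G) (@lg_log R G) X (lg_log x)).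

Definition tangent_pvector (R : realType) (G : expLieGroup R)
    (W : (lg_dim G).-tuple 'rV[R]_(lg_dim G)) (p : nat) (Sigma : set G) (x : G)
    (tau : pvector R (lg_dim G) p) : Prop :=
  (exists J, tau J != 0) /\
  exists v : 'I_p -> 'rV[R]_(lg_dim G),
    (forall i, lie_tangent Sigma x (v i)) /\ tau = wedge W v.

(* d_Sigma(x), computed on an arbitrarily chosen nonzero tangent p-vector. *)
Definition degree_at (R : realType) (G : expLieGroup R)
    (V1 : {vspace 'rV[R]_(lg_dim G)}) (W : (lg_dim G).-tuple 'rV[R]_(lg_dim G))
    (p : nat) (Sigma : set G) (x : G) : nat :=
  pvector_degree V1 W (xget [ffun => 0] (@tangent_pvector R G W p Sigma x)).

(* d = max_{x in Sigma} d_Sigma(x). *)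
Definition has_degree (R : realType) (G : expLieGroup R)
    (V1 : {vspace 'rV[R]_(lg_dim G)}) (W : (lg_dim G).-tuple 'rV[R]_(lg_dim G))
    (p : nat) (Sigma : set G) (d : nat) : Prop :=
  (exists2 x, Sigma x & degree_at V1 W p Sigma x = d) /\
  (forall x, Sigma x -> (degree_at V1 W p Sigma x <= d)%N).

Local Open Scope ereal_scope.

(* -oo when A is empty. *)
Definition diameter (R : realType) (T : Type) (rho : T -> T -> R) (A : set T)
    : \bar R :=
  ereal_sup [set (rho z.1 z.2)%:E | z in A `*` A].

(* The empty set has weight 0 for every exponent s, and a point has weight
   0 `^ 0 = 1 when s = 0. *)
Definition hausdorff_weight (R : realType) (T : Type) (rho : T -> T -> R)
    (s : R) (A : set T) : \bar R :=
  if A == set0 then 0 else diameter rho A `^ s.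

Definition hausdorff_pre (R : realType) (T : Type) (rho : T -> T -> R)
    (s eps : R) (A : set T) : \bar R :=
  ereal_inf [set \sum_(0 <= i <oo) hausdorff_weight rho s (B i) |
    B in [set B : (set T)^nat | A `<=` \bigcup_i B i /\
                                forall i, diameter rho (B i) <= eps%:E]].

(* Without the usual constant factor, which affects neither the finiteness of
   the measure nor the dimension. *)
Definition hausdorff_measure (R : realType) (T : Type) (rho : T -> T -> R)
    (s : R) (A : set T) : \bar R :=
  ereal_sup [set hausdorff_pre rho s eps A | eps in [set eps | (0 < eps)%R]].

Definition countably_finite (R : realType) (T : Type) (mu : set T -> \bar R)
    (A : set T) : Prop :=
  exists B : (set T)^nat,
    A = \bigcup_i B i /\ forall i, mu (B i) < +oo.

Definition hausdorff_dim (R : realType) (T : Type) (rho : T -> T -> R)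
    (A : set T) : \bar R :=
  ereal_inf [set s%:E | s in
    [set s | (0 <= s)%R /\ hausdorff_measure rho s A = 0]].

(* Main.v *)
(** Fix a point x = exp (phi u) of Sigma, where phi is a C^{1,1} chart of
    exp^-1(Sigma), and let F w be the logarithm of x^-1 exp (phi w). Then
    F w = dF (w - u) + O(|w - u|^2), and the degree of Sigma at x is
    k + 2 (p - k), where k is the dimension of the kernel of the V2-component of
    dF. This kernel is the graph of a linear map over k of the p coordinates, so
    that w - u = a B + b with a in R^k and b supported by the other coordinates.
    If |a| <= r and |b| <= r^2, then the V1-component of F w is O(r) and its
    V2-component is O(r^2), so that rho x (exp (phi w)) = O(r) by homogeneity.
    Hence x is at distance O(r) from the image of a point of the grid of R^p with
    mesh r in the k coordinates and mesh r^2 in the others. Such a grid has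
    O(r^-(k + 2 (p - k))) bounded points, whatever x is. Making the constants
    uniform on countably many pieces gives covers of each piece by O(r^-delta)
    sets of diameter O(r), for all small r. *)
From HB Require Import structures.
Require Import Defs.
From mathcomp Require Import all_boot all_order all_algebra.
From mathcomp Require Import fingroup perm.
From mathcomp Require Import all_classical all_reals all_analysis.
From mathcomp Require Import ring lra.
Set Implicit Arguments.
Unset Strict Implicit.
Unset Printing Implicit Defensive.
Import Order.TTheory GRing.Theory Num.Theory.
Import numFieldNormedType.Exports.
Local Open Scope classical_set_scope.
Local Open Scope ring_scope.


(** * Maximal minors and their weights *)

Lemma colsub_mul (F : fieldType) m n p k (f : 'I_k -> 'I_p) (A : 'M[F]_(m, n))
    (B : 'M[F]_(n, p)) : colsub f (A *m B) = A *m colsub f B.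
Proof. by apply/matrixP => i j; rewrite !mxE; apply: eq_bigr => l _; rewrite !mxE. Qed.

Lemma colsub_unit_inj (F : fieldType) p q (E : 'M[F]_(p, q)) (g : 'I_p -> 'I_q) :
  colsub g E \in unitmx -> injective g.
Proof.
move=> uE i j gij; apply/eqP/negPn/negP => ij; move: uE.
rewrite unitmxE -det_tr (determinant_alternate ij) ?unitr0// => l.
by rewrite !mxE gij.
Qed.

(** Sorting the columns multiplies the submatrix by a permutation matrix. This leads from arbitrary
    functions [g], whose values can be exchanged freely, to the increasing multi-indices that label
    coefficients of p-vectors. *)
Lemma sorted_minor (F : fieldType) p q (E : 'M[F]_(p, q)) (g : 'I_p -> 'I_q)
    (wt : 'I_q -> nat) : colsub g E \in unitmx ->
  exists J : multiindex p q, colsub (val J) E \in unitmx /\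
    (\sum_(i < p) wt (val J i) = \sum_(i < p) wt (g i))%N.
Proof.
move=> uE; have ginj := colsub_unit_inj uE.
pose t : p.-tuple 'I_q := [tuple g i | i < p].
pose r : rel 'I_q := fun a b => (a <= b)%N.
pose ts : p.-tuple 'I_q := [tuple of sort r t].
have : perm_eq ts t by rewrite perm_sort.
move=> /tuple_permP[s tsE].
have tsi i : tnth ts i = g (s i).
  by rewrite (tnth_nth (g i)) tsE (nth_map i) ?size_enum_ord// nth_ord_enum tnth_mktuple.
have sts : sorted r ts by apply: sort_sorted => a b; exact: leq_total.
pose h : {ffun 'I_p -> 'I_q} := [ffun i => g (s i)].
have hP : [forall i : 'I_p, forall j : 'I_p, (i < j)%N ==> (h i < h j)%N].
  apply/forallP => i; apply/forallP => j; apply/implyP => ij.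
  rewrite !ffunE ltn_neqAle; apply/andP; split.
    by apply/eqP => /val_inj/ginj/perm_inj e; rewrite e ltnn in ij.
  rewrite -!tsi !(tnth_nth (g i)).
  have rr : reflexive r by move=> a; exact: leqnn.
  have rt : transitive r by move=> a b c; exact: leq_trans.
  by apply: (sorted_leq_nth rt rr) => //; rewrite ?inE ?size_tuple// ltnW.
exists (exist _ h hP); split; last first.
  rewrite [RHS](reindex_inj (@perm_inj _ s)) /=.
  by apply: eq_bigr => i _; rewrite ffunE.
suff -> : colsub (val (exist _ h hP : multiindex p q)) E = col_perm s (colsub g E).
  by rewrite col_permE unitmx_mul uE unitmx_perm.
by apply/matrixP => i j; rewrite !mxE ffunE.
Qed.

(** The new submatrix differs from the identity in column [i] only, so its determinant is [E i j].
    This is the exchange step for maximal minors. *)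
Lemma unit_colsub_id_replace (F : fieldType) p q (E : 'M[F]_(p, q))
    (g : 'I_p -> 'I_q) (i : 'I_p) (j : 'I_q) : colsub g E = 1%:M ->
  E i j != 0 -> colsub (fun l => if l == i then j else g l) E \in unitmx.
Proof.
move=> gE Eij; rewrite -row_free_unit; apply: inj_row_free => v vE.
have gEE a b : E a (g b) = (a == b)%:R by have /matrixP/(_ a b) := gE; rewrite !mxE.
have v0 l : l != i -> v 0 l = 0.
  move=> li; have /matrixP/(_ 0 l) := vE; rewrite !mxE (bigD1 l)//= big1.
    by rewrite mxE (negPf li) gEE eqxx mulr1 addr0.
  by move=> a al; rewrite mxE (negPf li) gEE (negPf al) mulr0.
have vi : v 0 i = 0.
  have /matrixP/(_ 0 i) := vE; rewrite !mxE (bigD1 i)//= big1.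
    by rewrite mxE eqxx addr0 => /eqP; rewrite mulf_eq0 (negPf Eij) orbF => /eqP.
  by move=> a al; rewrite v0// mul0r.
apply/rowP => l; rewrite mxE; have [->//|/v0//] := eqVneq l i.
Qed.

Lemma row_free_unit_colsub (F : fieldType) p q (E : 'M[F]_(p, q)) :
  row_free E -> exists g : 'I_p -> 'I_q, colsub g E \in unitmx.
Proof.
move=> fE; have fET : row_full E^T by rewrite /row_full mxrank_tr.
exists (fullrankfun fET).
suff -> : colsub (fullrankfun fET) E = (rowsub (fullrankfun fET) E^T)^T.
  by rewrite unitmx_tr fullrowsub_unit.
by apply/matrixP => i j; rewrite !mxE.
Qed.

(* Take a nonzero minor of largest weight and the basis of the row space whose
   coordinates on its columns are the identity. By maximality, the basis vectors
   attached to columns of weight 1 vanish on all columns of weight 2. *)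
Lemma max_weight_minor (F : fieldType) p q (E : 'M[F]_(p, q)) (wt : 'I_q -> nat)
    (delta : nat) : row_free E -> (forall j, wt j = 1%N \/ wt j = 2%N) ->
  (forall J : multiindex p q, colsub (val J) E \in unitmx ->
    (\sum_(i < p) wt (val J i) <= delta)%N) ->
  exists k (B : 'M[F]_(k, p)) (f : 'I_k -> 'I_p),
    [/\ injective f, colsub f B = 1%:M, (k + 2 * (p - k) <= delta)%N &
        forall i j, wt j = 2%N -> (B *m E) i j = 0].
Proof.
move=> /row_free_unit_colsub[g0 ug0] wt12 Edelta.
pose P (g : {ffun 'I_p -> 'I_q}) := colsub g E \in unitmx.
have Pg0 : P [ffun i => g0 i].
  rewrite /P; suff -> : colsub [ffun i => g0 i] E = colsub g0 E by [].
  by apply/matrixP => i j; rewrite !mxE ffunE.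
case: (arg_maxnP (fun g : {ffun 'I_p -> 'I_q} => \sum_(i < p) wt (g i))%N Pg0) => g Pg gmax.
pose A := invmx (colsub g E).
have gAE : colsub g (A *m E) = 1%:M by rewrite colsub_mul mulVmx.
have AE0 i j : wt (g i) = 1%N -> wt j = 2%N -> (A *m E) i j = 0.
  move=> wi wj; apply/eqP/negPn/negP => nz.
  have u := unit_colsub_id_replace gAE nz.
  pose g' : {ffun 'I_p -> 'I_q} := [ffun l => if l == i then j else g l].
  have Pg' : P g'.
    rewrite /P.
    have -> : colsub g' E = colsub g E *m (A *m colsub g' E) by rewrite mulKVmx.
    rewrite unitmx_mul -colsub_mul (_ : _ \in unitmx = true)/=; last exact: Pg.
    suff -> : colsub g' (A *m E) = colsub (fun l => if l == i then j else g l) (A *m E) by [].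
    by apply/matrixP => a b; rewrite !mxE ffunE.
  have := gmax _ Pg'; rewrite /= leqNgt => /negP; apply.
  rewrite (bigD1 i)//= [X in (_ < X)%N](bigD1 i)//= !ffunE eqxx wi wj.
  rewrite [X in (_ < _ + X)%N](eq_bigr (fun l => wt (g l))); first by rewrite ltn_add2r.
  by move=> l /negPf li; rewrite ffunE li.
(* The rows of [A] indexed by [I1] are independent, and the corresponding rows of [A *m E] vanish on
   the columns of weight 2. *)
pose I1 := [set i | wt (g i) == 1%N]%SET.
pose B0 : 'M[F]_(#|I1|, p) := rowsub enum_val A.
have uA : A \in unitmx by rewrite unitmx_inv.
have fB0 : row_free B0.
  apply/row_freeP; exists (colsub enum_val (invmx A)).
  rewrite -colsub_mul; apply/matrixP => i j; rewrite !mxE.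
  have := mulmxV uA => /matrixP/(_ (enum_val i) (enum_val j)); rewrite !mxE.
  rewrite (inj_eq enum_val_inj) => <-; apply: eq_bigr => l _; by rewrite !mxE.
(* Dividing by an invertible block of [B0] makes its row space a graph over the coordinates in the
   image of [f]. *)
have [f uf] := row_free_unit_colsub fB0.
exists #|I1|, (invmx (colsub f B0) *m B0), f; split.
- exact: colsub_unit_inj uf.
- by rewrite colsub_mul mulVmx.
- have [J [uJ sJ]] := sorted_minor wt Pg.
  apply: leq_trans (Edelta J uJ); rewrite sJ (bigID (mem I1))/=.
  rewrite (eq_bigr (fun=> 1%N)); last by move=> i; rewrite inE => /eqP.
  rewrite [X in (_ <= _ + X)%N](eq_bigr (fun=> 2%N)); last first.
    by move=> i; rewrite inE; have [->|->] := wt12 (g i).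
  rewrite !sum_nat_const muln1 leq_add2l mulnC leq_mul2r /= leq_subLR.
  rewrite -{1}[p]card_ord -(cardsC I1) leq_add2l.
  by apply: subset_leq_card; apply/fintype.subsetP => i; rewrite inE => iI; rewrite unfold_in.
- move=> i j wj; rewrite -mulmxA mxE big1// => l _.
  rewrite -[X in _ * X]/((B0 *m E) l j).
  suff -> : (B0 *m E) l j = 0 by rewrite mulr0.
  rewrite -(AE0 (enum_val l) j)//; last by have := enum_valP l; rewrite inE => /eqP.
  by rewrite !mxE; apply: eq_bigr => a _; rewrite !mxE.
Qed.


(** * Hausdorff measures and fine covers *)

Lemma diameter_le (R : realType) (T : Type) (rho : T -> T -> R) (A : set T)
    (D : R) : (forall x y, A x -> A y -> rho x y <= D) ->
  (diameter rho A <= D%:E)%E.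
Proof.
move=> AD; apply: ge_ereal_sup => _ [[x y] [/= Ax Ay] <-].
by rewrite lee_fin AD.
Qed.

Lemma hausdorff_weight_ge0 (R : realType) (T : Type) (rho : T -> T -> R)
    (s : R) (A : set T) : (0 <= hausdorff_weight rho s A)%E.
Proof. by rewrite /hausdorff_weight; case: ifP => // _; exact: poweR_ge0. Qed.

Lemma hausdorff_weight_le (R : realType) (T : Type) (rho : T -> T -> R)
    (s : R) (A : set T) (D : R) : (forall x y, 0 <= rho x y) -> 0 <= s ->
  0 <= D -> (forall x y, A x -> A y -> rho x y <= D) ->
  (hausdorff_weight rho s A <= (D `^ s)%:E)%E.
Proof.
move=> rho0 s0 D0 AD; rewrite /hausdorff_weight; case: ifPn => [_|/set0P[x Ax]].
  by rewrite lee_fin powR_ge0.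
have d0 : (0 <= diameter rho A)%E.
  apply: (@le_trans _ _ (rho x x)%:E); first by rewrite lee_fin.
  by apply: ereal_sup_ubound; exists (x, x).
rewrite -poweR_EFin; apply: gt0_ler_poweR => //; rewrite ?in_itv/= ?d0 ?leey ?lee_fin ?D0//.
exact: diameter_le.
Qed.

Lemma hausdorff_pre_finite_cover (R : realType) (T : Type) (rho : T -> T -> R)
    (s eps : R) (A : set T) (I : finType) (B : I -> set T) (D : R) :
  (forall x y, 0 <= rho x y) -> 0 <= s -> 0 <= D -> D <= eps ->
  (forall x, A x -> exists i, B i x) ->
  (forall i x y, B i x -> B i y -> rho x y <= D) ->
  (hausdorff_pre rho s eps A <= (#|I|%:R * D `^ s)%:E)%E.
Proof.
move=> rho0 s0 D0 Deps AB BD.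
(* Empty sets complete the finite cover to a sequence; their weight is 0 even for exponent 0. *)
pose B' (n : nat) : set T :=
  if (insub n : option 'I_#|I|) is Some i then B (enum_val i) else set0.
have B'D n x y : B' n x -> B' n y -> rho x y <= D.
  by rewrite /B'; case: insub => [i|//]; exact: BD.
apply: (@le_trans _ _ (\sum_(0 <= i <oo) hausdorff_weight rho s (B' i))%E).
  apply: ereal_inf_lbound; exists B' => //; split => [x /AB[i Bix]|n].
    exists (enum_rank i) => //.
    rewrite /B'; case: insubP => [j _ jE|]; last by rewrite ltn_ord.
    by rewrite (val_inj jE) enum_rankK.
  by apply: le_trans (diameter_le (B'D n)) _; rewrite lee_fin.
rewrite (nneseries_split 0 #|I|); last by move=> k _; exact: hausdorff_weight_ge0.
rewrite [X in (_ + X)%E]eseries0 ?adde0; last first.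
  move=> i; rewrite add0n => Ii _; rewrite /B' insubF ?ltnNge ?Ii//.
  by rewrite /hausdorff_weight eqxx.
rewrite add0n big_mkord; apply: (@le_trans _ _ (\sum_(i < #|I|) (D `^ s)%:E)%E).
  by apply: lee_sum => i _; apply: hausdorff_weight_le => //; exact: B'D.
by rewrite sumEFin sumr_const card_ord mulr_natl.
Qed.

Lemma nneseries_pair (R : realType) (w : nat -> nat -> \bar R)
    (f : {bij [set: nat] >-> [set: nat * nat]}) : (forall i j, (0 <= w i j)%E) ->
  (\sum_(0 <= k <oo) w (f k).1 (f k).2 =
   \sum_(0 <= i <oo) \sum_(0 <= j <oo) w i j)%E.
Proof.
move=> w0; rewrite nneseries_esumT// nneseries_esumT; last first.
  by move=> i; exact: nneseries_ge0.
under [RHS]eq_esum do rewrite nneseries_esumT//.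
rewrite esum_esum//.
rewrite (@reindex_esum _ _ _ [set: nat] (setT `*`` (fun=> setT)) f)//.
have -> : [set: nat] `*`` (fun=> [set: nat]) = setT by apply/seteqP; split.
exact: bij.
Qed.

Lemma hausdorff_pre_ge0 (R : realType) (T : Type) (rho : T -> T -> R)
    (s eps : R) (A : set T) : (0 <= hausdorff_pre rho s eps A)%E.
Proof.
apply: le_ereal_inf_tmp => _ [B _ <-].
by apply: nneseries_ge0 => *; exact: hausdorff_weight_ge0.
Qed.

(** As for countable subadditivity: [A n] is covered with total weight at most [e / 2 ^ (n + 1)],
    and a bijection of [nat] with [nat * nat] enumerates all the covering sets. *)
Lemma hausdorff_pre_bigcup0 (R : realType) (T : Type) (rho : T -> T -> R)
    (s eps : R) (A : (set T)^nat) :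
  (forall n, hausdorff_pre rho s eps (A n) = 0%E) ->
  hausdorff_pre rho s eps (\bigcup_n A n) = 0%E.
Proof.
move=> A0; apply/eqP; rewrite eq_le hausdorff_pre_ge0 andbT.
apply/lee_addgt0Pr => e e0; rewrite add0e.
pose P n (B : (set T)^nat) := [/\ A n `<=` \bigcup_i B i,
  forall i, (diameter rho (B i) <= eps%:E)%E &
  (\sum_(0 <= k <oo) hausdorff_weight rho s (B k) <= (e / (2 ^ n.+1)%:R)%:E)%E].
have [G PG] : {G : ((set T)^nat)^nat & forall n, P n (G n)}.
  apply: (@choice _ _ P) => n.
  have en0 : 0 < e / (2 ^ n.+1)%:R by rewrite divr_gt0// ltr0n expn_gt0.
  have Afin : hausdorff_pre rho s eps (A n) \is a fin_num by rewrite A0.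
  have [_ [B [AB Beps] <-]] := lb_ereal_inf_adherent en0 Afin.
  rewrite -/(hausdorff_pre rho s eps (A n)) A0 add0e => /ltW ?.
  by exists B.
have /card_esym/ppcard_eqP[f] := card_nat2.
apply: (@le_trans _ _
  (\sum_(0 <= k <oo) hausdorff_weight rho s (G (f k).1 (f k).2))%E).
  apply: ereal_inf_lbound; exists (fun k => G (f k).1 (f k).2) => //.
  split => [x [n _ Anx]|i]; last by have [_ h _] := PG (f i).1; exact: h.
  have [/(_ _ Anx)[j _ Gnj] _ _] := PG n.
  by exists (f^-1%FUN (n, j)) => //=; rewrite invK ?inE.
rewrite (nneseries_pair (w := fun i j => hausdorff_weight rho s (G i j)) f); last first.
  by move=> *; exact: hausdorff_weight_ge0.
apply: le_trans (epsilon_trick0 xpredT (ltW e0)).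
apply: lee_nneseries => [i _ _|i _]; last by have [] := PG i.
by apply: nneseries_ge0 => *; exact: hausdorff_weight_ge0.
Qed.

(** A box-counting bound of exponent [delta] at the scales [1 / M]. The same [C] is the threshold
    for [M], the factor in the number of sets and the factor in their diameters. *)
Definition finely_covered (R : realType) (T : Type) (rho : T -> T -> R)
    (delta : nat) (A : set T) : Prop :=
  exists C : nat, forall M : nat, (C < M)%N ->
    exists (I : finType) (B : I -> set T),
      [/\ forall x, A x -> exists i, B i x, (#|I| <= C * M ^ delta)%N &
          forall i x y, B i x -> B i y -> rho x y <= C%:R / M%:R].

Lemma finely_coveredS (R : realType) (T : Type) (rho : T -> T -> R)
    (delta : nat) (A A' : set T) :
  A `<=` A' -> finely_covered rho delta A' -> finely_covered rho delta A.
Proof.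
move=> AA' [C CP]; exists C => M /CP[I [B [A'B cI BD]]].
by exists I, B; split => // x /AA'; exact: A'B.
Qed.

(** With [D = C / M], the weights add up to at most [C * M ^ delta * D ^ s = C * C ^ delta * D ^ (s
    - delta)]. This is bounded for [s = delta], and tends to 0 with [D] for [s > delta]. *)
Lemma finely_covered_pre (R : realType) (T : Type) (rho : T -> T -> R)
    (delta : nat) (A : set T) : (forall x y, 0 <= rho x y) ->
  finely_covered rho delta A -> exists2 K : R, 0 <= K &
  forall s eps D0, delta%:R <= s -> 0 < eps -> 0 < D0 -> exists D,
    [/\ 0 <= D, D <= D0 &
        (hausdorff_pre rho s eps A <= (K * D `^ (s - delta%:R))%:E)%E].
Proof.
move=> rho0 [C CP]; exists (C%:R * C%:R ^+ delta) => [|s eps D0 sd eps0 D00].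
  by rewrite mulr_ge0 ?exprn_ge0.
pose e := Num.min eps D0.
have e0 : 0 < e by rewrite lt_min eps0.
have [M CM Me] : exists2 M : nat, (C < M)%N & C%:R / M%:R <= e.
  pose M0 := Num.truncn (C%:R / e).
  exists (maxn C.+1 M0.+1); first by rewrite leq_max leqnn.
  rewrite ler_pdivrMr ?ltr0n ?leq_max// mulrC -ler_pdivrMr//.
  apply: (@le_trans _ _ (M0.+1%:R)).
    by apply/ltW; rewrite truncnS_gt.
  by rewrite ler_nat leq_max leqnn orbT.
have [I [B [AB cI BD]]] := CP M CM.
have M0 : 0 < M%:R :> R by rewrite ltr0n (leq_trans _ CM).
have D0' : 0 <= C%:R / M%:R :> R by rewrite divr_ge0.
exists (C%:R / M%:R); split => //; first by apply: le_trans Me _; rewrite ge_min lexx orbT.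
have Deps : C%:R / M%:R <= eps by apply: le_trans Me _; rewrite ge_min lexx.
have s0 : 0 <= s by apply: le_trans sd.
apply: le_trans (hausdorff_pre_finite_cover rho0 s0 D0' Deps AB BD) _.
rewrite lee_fin; set D := C%:R / M%:R.
(* If [C = 0] then [D = 0] and the power of [D] cannot be split, but the cover is then empty. *)
have [C0|C0] := eqVneq C 0%N.
  move: cI; rewrite C0 mul0n leqn0 => /eqP ->.
  by rewrite mul0r mulr_ge0 ?powR_ge0// mul0r.
have -> : D `^ s = D ^+ delta * D `^ (s - delta%:R).
  rewrite -powR_mulrn// -powRD ?subrKC//.
  by apply/implyP => _; rewrite mulf_neq0 ?invr_neq0// ?pnatr_eq0// -(pnatr_eq0 R) gt_eqF.
rewrite mulrA ler_wpM2r ?powR_ge0//.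
apply: (@le_trans _ _ ((C * M ^ delta)%:R * D ^+ delta)).
  by rewrite ler_wpM2r ?exprn_ge0// ler_nat.
by rewrite natrM natrX -mulrA ler_wpM2l// /D exprMn mulrCA -exprMn mulfV ?gt_eqF// expr1n mulr1.
Qed.

Lemma finely_covered_measure (R : realType) (T : Type) (rho : T -> T -> R)
    (delta : nat) (A : set T) : (forall x y, 0 <= rho x y) ->
  finely_covered rho delta A ->
  (hausdorff_measure rho delta%:R A < +oo)%E.
Proof.
move=> rho0 /(finely_covered_pre rho0)[K K0 KP].
apply: (@le_lt_trans _ _ K%:E); last by rewrite ltry.
apply: ge_ereal_sup => _ [eps /= eps0 <-].
have [D [_ _ h]] := KP delta%:R eps 1 (lexx _) eps0 ltr01.
by apply: le_trans h _; rewrite subrr powRr0 mulr1.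
Qed.

Lemma finely_covered_pre0 (R : realType) (T : Type) (rho : T -> T -> R)
    (delta : nat) (A : set T) (s eps : R) : (forall x y, 0 <= rho x y) ->
  finely_covered rho delta A -> delta%:R < s -> 0 < eps ->
  hausdorff_pre rho s eps A = 0%E.
Proof.
move=> rho0 /(finely_covered_pre rho0)[K K0 KP] sd eps0.
apply/eqP; rewrite eq_le hausdorff_pre_ge0 andbT.
apply/lee_addgt0Pr => e e0; rewrite add0e.
have t0 : 0 < s - delta%:R by rewrite subr_gt0.
have K1 : 0 < K + 1 by rewrite ltr_wpDl.
(* The bound on [D] is chosen so that its power of exponent [s - delta] is [e / (K + 1)]; adding 1
   keeps the denominator positive. *)
have [|D [D0 DD h]] := KP s eps ((e / (K + 1)) `^ (s - delta%:R)^-1) (ltW sd) eps0.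
  by rewrite powR_gt0// divr_gt0.
apply: le_trans h _; rewrite lee_fin.
apply: (@le_trans _ _ ((K + 1) * (e / (K + 1)))); last by rewrite mulrCA divff ?gt_eqF// mulr1.
rewrite ler_pM ?powR_ge0 ?lerDl//.
have q0 : 0 <= e / (K + 1) by rewrite divr_ge0// ltW.
apply: le_trans (ge0_ler_powR (ltW t0) _ _ DD) _; rewrite ?nnegrE ?powR_ge0//.
by rewrite -powRrM mulVf ?gt_eqF// powRr1.
Qed.

(** For the dimension, every exponent [delta + e] with [e > 0] gives measure 0 to the union, since
    all the premeasures of all the pieces vanish. *)
Lemma finely_covered_bigcup (R : realType) (T : Type) (rho : T -> T -> R)
    (delta : nat) (A : (set T)^nat) : (forall x y, 0 <= rho x y) ->
  (forall n, finely_covered rho delta (A n)) ->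
  countably_finite (hausdorff_measure rho delta%:R) (\bigcup_n A n) /\
  (hausdorff_dim rho (\bigcup_n A n) <= (delta%:R)%:E)%E.
Proof.
move=> rho0 Acov; split.
  by exists A; split => // n; exact: finely_covered_measure.
apply/lee_addgt0Pr => e e0; apply: ereal_inf_lbound.
exists (delta%:R + e) => //; split; first by apply: addr_ge0 => //; exact: ltW.
apply/eqP; rewrite eq_le; apply/andP; split.
  apply: ge_ereal_sup => _ [eps /= eps0 <-].
  rewrite hausdorff_pre_bigcup0// => n.
  by apply: finely_covered_pre0 (Acov n) _ _ => //; rewrite ltrDl.
apply: le_trans (hausdorff_pre_ge0 rho (delta%:R + e) 1 (\bigcup_n A n)) _.
by apply: ereal_sup_ubound; exists 1 => //=.
Qed.


(** * Matrix norms, derivatives and quadratic remainders *)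

Lemma mx_entry_norm_le (R : realType) m n (x : 'M[R]_(m, n)) i j :
  `|x i j| <= `|x|.
Proof.
by rewrite [leRHS]/Num.norm /= mx_normrE; apply/bigmax_geP; right => /=; exists (i, j).
Qed.

Lemma mx_norm_le (R : realType) m n (x : 'M[R]_(m, n)) c :
  0 <= c -> (forall i j, `|x i j| <= c) -> `|x| <= c.
Proof.
move=> c0 xc; rewrite [leLHS]/Num.norm /= mx_normrE.
by apply/bigmax_leP; split => // -[i j] _; exact: xc.
Qed.

(** The norm is the largest absolute value of an entry, whence the factor [n], the number of terms
    in an entry of the product. *)
Lemma mulmx_norm_le (R : realType) m n p (x : 'M[R]_(m, n)) (A : 'M[R]_(n, p)) :
  `|x *m A| <= n%:R * `|x| * `|A|.
Proof.
apply: mx_norm_le => [|i j]; first by rewrite !mulr_ge0.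
rewrite mxE; apply: le_trans (ler_norm_sum _ _ _) _.
apply: le_trans (_ : \sum_(k < n) `|x| * `|A| <= _); last first.
  by rewrite sumr_const card_ord -mulrA mulr_natl.
by apply: ler_sum => k _; rewrite normrM ler_pM// mx_entry_norm_le.
Qed.

Lemma diff_jacobian (R : realType) m n (f : 'rV[R]_m -> 'rV[R]_n) u v :
  'd f u v = v *m 'J f u.
Proof. by rewrite /jacobian mul_rV_lin1. Qed.

Lemma differentiable_approx (R : realType) (U W : normedModType R) (f : U -> W)
    (u : U) (e : R) : differentiable f u -> 0 < e ->
  \forall w \near u, `|f w - f u - 'd f u (w - u)| <= e * `|w - u|.
Proof.
move=> /diff_locally/eqaddoP/(_ e) + e0 => /(_ e0).
rewrite [X in _ -> X](near_shift 0 u) => h; near=> w.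
rewrite subr0 /= addrK.
have -> : f (w + u) - f u - 'd f u w =
  (f \o shift u - (cst (f u) + 'd f u)) w by rewrite /= !fctE /= opprD addrA.
near: w; exact: h.
Unshelve. all: by end_near. Qed.

Lemma is_derive_line (R : realType) m n (f : 'rV[R]_m -> 'rV[R]_n) u h (t : R) :
  differentiable f (u + t *: h) ->
  is_derive t (1 : R) (fun s : R => f (u + s *: h)) (h *m 'J f (u + t *: h)).
Proof.
move=> df; have df' := differentiableP df.
have dl : is_diff t (fun s : R => u + s *: h) ( *:%R^~ h).
  by apply: is_diff_eq; rewrite add0r.
have dg : is_diff t (f \o (fun s : R => u + s *: h)) ('d f (u + t *: h) \o *:%R^~ h).
  exact: is_diff_comp.
apply: DeriveDef; first by apply: diff_derivable; case: dg.
rewrite deriveE; last by case: dg.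
case: dg => _ /(congr1 (fun F => F 1)) /=; rewrite scale1r diff_jacobian; exact.
Qed.

Lemma is_derive_coord (R : realType) n (g : R -> 'rV[R]_n) (t : R) v j :
  is_derive t (1 : R) g v -> is_derive t (1 : R) (fun s : R => g s 0 j : R) (v 0 j).
Proof.
move=> [/derivable1_diffP dg dgE].
pose c : 'rV[R]_n -> R := fun N => N 0 j.
have clin : linear c by move=> a x y; rewrite /c !mxE.
pose cL : {linear 'rV[R]_n -> R} := HB.pack c (GRing.isLinear.Build _ _ _ _ c clin).
have ccont : continuous cL by exact: coord_continuous.
have dc x : is_diff x cL cL.
  by apply: DiffDef; [exact: linear_differentiable | exact: diff_lin].
have dg' := differentiableP dg.
have dcg : is_diff t (cL \o g) (cL \o 'd g t) by exact: is_diff_comp.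
apply: DeriveDef; first by apply: diff_derivable; case: dcg.
rewrite deriveE; last by case: dcg.
case: dcg => _ /(congr1 (fun F => F 1)) ->; rewrite /= -[in RHS]dgE deriveE//.
Qed.

(* Mean value theorem along the segment from u to w, coordinate by coordinate. *)
Lemma quadratic_remainder (R : realType) m n (f : 'rV[R]_m -> 'rV[R]_n) u (K : R) :
  0 <= K ->
  (\forall v \near u, differentiable f v /\ `|'J f v - 'J f u| <= K * `|v - u|) ->
  \forall w \near u,
    `|f w - f u - (w - u) *m 'J f u| <= m%:R * K * `|w - u| ^+ 2.
Proof.
move=> K0 /nbhs_normP[e /= e0 he]; apply/nbhs_normP; exists e => //= w /= uw.
apply: mx_norm_le => [|i j]; first by rewrite !mulr_ge0 ?exprn_ge0.
rewrite ord1; set h := w - u.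
have ball_seg (t : R) : 0 <= t <= 1 -> `|u - (u + t *: h)| < e.
  move=> /andP[t0 t1]; rewrite opprD addrA subrr sub0r normrN normrZ ger0_norm//.
  by apply: le_lt_trans uw; rewrite distrC ler_piMl.
pose g (t : R) : R := f (u + t *: h) 0 j.
pose dg (t : R) : R := (h *m 'J f (u + t *: h)) 0 j.
have gd (t : R) : 0 <= t <= 1 -> is_derive t (1 : R) g (dg t).
  by move=> /ball_seg/he[df _]; apply: is_derive_coord; exact: is_derive_line.
have [c /[1!in_itv]/= c01 gE] : exists2 c, c \in `[0, 1]%R & g 1 - g 0 = dg c * (1 - 0).
  apply: MVT_segment => // [x /[1!in_itv]/= /andP[x0 x1]|].
    by apply: gd; rewrite !ltW.
  apply: derivable_within_continuous => x /[1!in_itv]/= x01.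
  by have [] := gd x x01.
have -> : (f w - f u - h *m 'J f u) 0 j = (h *m ('J f (u + c *: h) - 'J f u)) 0 j.
  have E : (f w - f u) 0 j = dg c.
    move: gE; rewrite /g scale1r scale0r addr0 subr0 mulr1 => <-.
    by rewrite /h subrKC mxE [(- f u) 0 j]mxE.
  by rewrite mulmxBr mxE E [RHS]mxE.
apply: le_trans (mx_entry_norm_le _ _ _) _; apply: le_trans (mulmx_norm_le _ _) _.
have [_ hJ] := he _ (ball_seg c c01).
rewrite expr2 -!mulrA ler_wpM2l// [leRHS]mulrCA ler_wpM2l//.
apply: le_trans hJ _; rewrite ler_wpM2l// addrC addKr normrZ.
by case/andP: c01 => c0 c1; rewrite ger0_norm// ler_piMl.
Qed.

(** The rows of the Jacobian are the directional derivatives [F i]. Each is differentiable at [u],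
    so its increment is at most its linear part plus [|x - u|]. *)
Lemma jacobian_lipschitz_at (R : realType) m n (f : 'rV[R]_m -> 'rV[R]_n) u :
  (forall v, differentiable (fun x => 'd f x v : 'rV[R]_n) u) ->
  exists2 K : R, 0 <= K & \forall x \near u, `|'J f x - 'J f u| <= K * `|x - u|.
Proof.
move=> df2.
pose F i := fun x => 'd f x (delta_mx 0 i) : 'rV[R]_n.
pose K i := m%:R * `|'J (F i) u| + 1.
have K0 i : 0 <= K i by rewrite addr_ge0// mulr_ge0.
have near_row i : \forall x \near u, `|F i x - F i u| <= K i * `|x - u|.
  have dF : differentiable (F i) u by exact: df2.
  have := differentiable_approx dF ltr01.
  apply: filterS => x; have -> := diff_jacobian (F i) u (x - u); rewrite mul1r => hx.
  rewrite -[F i x - F i u](subrK ((x - u) *m 'J (F i) u)) mulrDl mul1r addrC.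
  by apply: le_trans (ler_normD _ _) _; rewrite lerD// mulrAC mulmx_norm_le.
exists (\sum_i K i); first by apply: sumr_ge0.
have : \forall x \near u, forall i, `|F i x - F i u| <= K i * `|x - u|.
  exact: (filter_forall _ near_row).
apply: filterS => x hx; apply: mx_norm_le => [|i j]; first by rewrite mulr_ge0 ?sumr_ge0.
apply: (@le_trans _ _ (K i * `|x - u|)).
  have -> : ('J f x - 'J f u) i j = (F i x - F i u) 0 j by rewrite /F /jacobian !mxE.
  exact: le_trans (mx_entry_norm_le _ _ _) (hx i).
by rewrite ler_wpM2r// (bigD1 i)//= lerDl sumr_ge0.
Qed.

(** The error is the remainder of [g] at [f w] plus the image by [B] of the remainder of [f]. The
    first is quadratic in [w - u] because [|f w - f u| <= L * |w - u|] as soon as [|w - u| <= 1]. *)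
Lemma quadratic_remainder_comp (R : realType) m n p (f : 'rV[R]_m -> 'rV[R]_n)
    (g : 'rV[R]_n -> 'rV[R]_p) u A B (K1 K2 : R) : {for u, continuous f} ->
  0 <= K1 -> 0 <= K2 ->
  (\forall w \near u, `|f w - f u - (w - u) *m A| <= K1 * `|w - u| ^+ 2) ->
  (\forall y \near f u, `|g y - g (f u) - (y - f u) *m B| <= K2 * `|y - f u| ^+ 2) ->
  exists2 K : R, 0 <= K & \forall w \near u,
    `|g (f w) - g (f u) - (w - u) *m (A *m B)| <= K * `|w - u| ^+ 2.
Proof.
move=> fc K10 K20 fA gB.
pose L := K1 + m%:R * `|A|.
have L0 : 0 <= L by rewrite addr_ge0// mulr_ge0.
exists (K2 * L ^+ 2 + n%:R * K1 * `|B|).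
  by rewrite addr_ge0// !mulr_ge0// exprn_ge0.
have near1 : \forall w \near u, `|w - u| <= 1.
  by apply/nbhs_normP; exists 1 => //= w /=; rewrite distrC => /ltW.
have gB' := fc _ gB.
near=> w.
have h1 : `|w - u| <= 1 by near: w.
have fw : `|f w - f u - (w - u) *m A| <= K1 * `|w - u| ^+ 2 by near: w.
have gw : `|g (f w) - g (f u) - (f w - f u) *m B| <= K2 * `|f w - f u| ^+ 2.
  by near: w.
move: h1 fw; set h := w - u => h1 fw.
have fL : `|f w - f u| <= L * `|h|.
  rewrite -[f w - f u](subrK (h *m A)); apply: le_trans (ler_normD _ _) _.
  rewrite mulrDl lerD//; last by rewrite mulrAC mulmx_norm_le.
  by apply: le_trans fw _; rewrite ler_wpM2l// expr2 ler_piMl.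
have -> : g (f w) - g (f u) - h *m (A *m B) =
    (g (f w) - g (f u) - (f w - f u) *m B) + (f w - f u - h *m A) *m B.
  by rewrite [(_ - h *m A) *m B]mulmxBl mulmxA addrA subrK.
apply: le_trans (ler_normD _ _) _; rewrite mulrDl lerD//.
  apply: le_trans gw _; rewrite -mulrA ler_wpM2l// -exprMn lerXn2r ?nnegrE//.
  by rewrite mulr_ge0.
apply: le_trans (mulmx_norm_le _ _) _.
by rewrite [leRHS]mulrAC ler_wpM2r// -mulrA ler_wpM2l//.
Unshelve. all: by end_near. Qed.


(** * Left translations in the coordinates [log], and homogeneous balls *)

Lemma diff_comp_id (R : realType) n (f g : 'rV[R]_n -> 'rV[R]_n) x y v :
  f x = y -> differentiable f x -> differentiable g y -> cancel f g ->
  'd g y ('d f x v) = v.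
Proof.
move=> <- df dg fK; have := diff_comp df dg => /(congr1 (fun F => F v)) /= <-.
have -> : g \o f = id by apply/funext => w /=; exact: fK.
by have [_ ->] := is_diff_id x.
Qed.

Section translations.
Variables (R : realType) (G : expLieGroup R).
Local Notation q := (lg_dim G).
Local Notation exp := (@lg_exp R G).
Local Notation log := (@lg_log R G).

(** By conversion, [left_inv_field] at [z] is the differential at 0 of this map. *)
Definition log_translate (z y : 'rV[R]_q) : 'rV[R]_q := log (exp z * exp y)%g.

Definition log_inv (z : 'rV[R]_q) : 'rV[R]_q := log (exp z)^-1%g.

Lemma lg_exp0 : exp 0 = 1%g.
Proof.
have := lg_oneparam (0 : 'rV[R]_q) 0 0; rewrite !scaler0 => /(congr1 (fun x => (exp 0)^-1 * x)%g).
by rewrite mulKg mulVg => ->.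
Qed.

Lemma lg_log1 : log 1%g = 0.
Proof. by rewrite -lg_exp0 lg_expK. Qed.

Lemma log_translateK z : cancel (log_translate z) (log_translate (log_inv z)).
Proof. by move=> y; rewrite /log_translate /log_inv !lg_logK mulKg lg_expK. Qed.

Lemma log_translateVK z : cancel (log_translate (log_inv z)) (log_translate z).
Proof. by move=> y; rewrite /log_translate /log_inv !lg_logK mulVKg lg_expK. Qed.

Lemma log_translate0 z : log_translate z 0 = z.
Proof. by rewrite /log_translate lg_exp0 mulg1 lg_expK. Qed.

Lemma log_translateV z : log_translate (log_inv z) z = 0.
Proof. by rewrite -{2}(log_translate0 z) log_translateK. Qed.

Let is_diff_pairl z y :
  is_diff y (fun y : 'rV[R]_q => (z, y)) (fun v => (0 : 'rV[R]_q, v)).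
Proof. exact: is_diff_pair. Qed.

Lemma log_translate_diff z y : differentiable (log_translate z) y.
Proof.
have [dm _] := lg_mul_smooth G 1.
have [dp _] := is_diff_pairl z y.
exact: (differentiable_comp dp (dm (z, y))).
Qed.

(** By the chain rule, the differential in [x] along [v] is that of the group law at [(z, x)] along
    [(0, v)], and the group law is twice differentiable. *)
Lemma log_translate_diff2 z y v :
  differentiable (fun x => 'd (log_translate z) x v : 'rV[R]_q) y.
Proof.
pose m (w : 'rV[R]_q * 'rV[R]_q) := log (exp w.1 * exp w.2)%g.
have [dm d2m] : is_Ck 2 m := lg_mul_smooth G 2.
have -> : (fun x => 'd (log_translate z) x v : 'rV[R]_q) =
    (fun w => 'd m w (0, v) : 'rV[R]_q) \o (fun x => (z, x)).
  apply/funext => x /=; have [dp dpE] := is_diff_pairl z x.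
  have := diff_comp dp (dm (z, x)) => /(congr1 (fun F => F v)) /=.
  by rewrite dpE.
have [dp _] := is_diff_pairl z y.
have [d2 _] := d2m (0, v).
exact: (differentiable_comp dp (d2 (z, y))).
Qed.

Lemma log_translate_diffK z X :
  'd (log_translate (log_inv z)) z ('d (log_translate z) 0 X) = X.
Proof.
apply: diff_comp_id (log_translate0 z) _ _ (log_translateK z); exact: log_translate_diff.
Qed.

Lemma log_translate_diffVK z Y :
  'd (log_translate z) 0 ('d (log_translate (log_inv z)) z Y) = Y.
Proof.
apply: diff_comp_id (log_translateV z) _ _ (log_translateVK z); exact: log_translate_diff.
Qed.

Lemma log_translate_quadratic z y : exists2 K : R, 0 <= K &
  \forall x \near y, `|log_translate z x - log_translate z y
    - (x - y) *m 'J (log_translate z) y| <= K * `|x - y| ^+ 2.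
Proof.
have [K K0 hK] := jacobian_lipschitz_at (log_translate_diff2 z y).
exists (q%:R * K); first by rewrite mulr_ge0.
apply: quadratic_remainder => //; apply: filterS hK => x hx; split => //.
exact: log_translate_diff.
Qed.

(** Continuity of [rho] at the unit element makes a small box a subset of the unit ball; dilating by
    [r] gives all the other radii. *)
Lemma homogeneous_ball (V1 V2 : {vspace 'rV[R]_q}) (rho : G -> G -> R) :
  (V1 :&: V2)%VS = 0%VS -> (V1 + V2)%VS = fullv ->
  homogeneous_distance V1 V2 rho ->
  exists2 e : R, 0 < e & forall r y, 0 < r ->
    `|daddv_pi V1 V2 y| <= e * r -> `|daddv_pi V2 V1 y| <= e * r ^+ 2 ->
    rho 1%g (exp y) <= r.
Proof.
move=> V120 V12 hrho.
have c0 : rho 1%g 1%g = 0 by apply/(hd_eq0 hrho).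
have := @hd_continuous _ _ _ _ _ hrho (0, 0).
move=> /cvgrPdist_lt/(_ 1 ltr01); rewrite /= lg_exp0 c0 => -[[A1 A2] /= [A10 A20]] hA.
have /nbhs_normP[e /= e0 he] := A20.
exists (e / 3) => [|r y r0 y1 y2]; first by rewrite divr_gt0.
(* The dilation of [y] by the inverse of [r]. Its two components have norm at most [e / 3], so that
   their sum has norm less than [e]. *)
pose y' := r^-1 *: daddv_pi V1 V2 y + r ^- 2 *: daddv_pi V2 V1 y.
have V210 : (V2 :&: V1)%VS = 0%VS by rewrite capvC.
have pi_add w : daddv_pi V1 V2 w + daddv_pi V2 V1 w = w.
  by rewrite daddv_pi_add// V12 memvf.
have pi12 x : daddv_pi V1 V2 (daddv_pi V2 V1 x) = 0.
  have := pi_add (daddv_pi V2 V1 x); rewrite [X in _ + X]daddv_pi_proj//.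
  by move=> /(canRL (addrK _)); rewrite subrr.
have pi21 x : daddv_pi V2 V1 (daddv_pi V1 V2 x) = 0.
  have := pi_add (daddv_pi V1 V2 x); rewrite [X in X + _]daddv_pi_proj//.
  by move=> /(canRL (addKr _)); rewrite addNr.
have yE : lie_dilation V1 V2 r y' = y.
  rewrite /lie_dilation /y' !linearD !linearZ /= pi12 pi21.
  rewrite !daddv_pi_proj// !scaler0 addr0 add0r.
  rewrite !scalerA mulVf ?gt_eqF// mulVf ?gt_eqF ?exprn_gt0// !scale1r.
  exact: pi_add.
have y'e : `|y'| < e.
  apply: le_lt_trans (ler_normD _ _) _; rewrite !normrZ.
  have -> : e = e / 3 + e / 3 + e / 3 by field.
  rewrite ltr_pwDr ?divr_gt0//; apply: lerD.
    by rewrite ger0_norm ?invr_ge0 ?(ltW r0)// ler_pdivrMl// mulrC.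
  by rewrite ger0_norm ?invr_ge0 ?exprn_ge0 ?(ltW r0)// ler_pdivrMl ?exprn_gt0// mulrC.
have rhoy' : rho 1%g (exp y') < 1.
  have := hA (0, y'); rewrite /= lg_exp0 sub0r normrN; move=> h.
  apply: le_lt_trans (h _); first exact: ler_norm.
  split => /=; first exact: nbhs_singleton.
  by apply: he; rewrite /= sub0r normrN.
have <- : dilation V1 V2 r (exp y') = exp y.
  by rewrite /dilation lg_expK yE.
have dil1 : dilation V1 V2 r (1%g : G) = 1%g.
  by rewrite /dilation /lie_dilation lg_log1 !linear0 ?scaler0 addr0 lg_exp0.
by rewrite -dil1 (hd_homogeneous hrho)// ler_piMr// ltW.
Qed.

End translations.

(** * Tangent vectors of a parametrized submanifold *)

(* P annihilates the row space of the Jacobian, so that (phi w - phi u) P is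
   o(|w - u|), and |w - u| = O(|phi w - phi u|) because phi is an immersion.
   Since phi is open onto its image, gamma t = phi w with w close to u. *)
Lemma tangent_vector_sub_jacobian (R : realType) p q (S : set 'rV[R]_q)
    (V : set 'rV[R]_p) (phi : 'rV[R]_p -> 'rV[R]_q) u v :
  open V -> V u -> differentiable phi u -> row_free ('J phi u) ->
  (forall O, open O -> O `<=` V -> exists U, open U /\ phi @` O = S `&` U) ->
  tangent_vector S (phi u) v -> (v <= 'J phi u)%MS.
Proof.
move=> oV Vu dphi fJ homeo [gamma [g0 gS gder]].
set J := 'J phi u in fJ *; rewrite submxE; set P := cokermx J.
(* A right inverse of [J] bounds [|x|] by [c * |x J|]: this is where the immersion is used. *)
pose c : R := q%:R * `|pinvmx J| + 1.
have c0 : 0 < c by rewrite ltr_wpDl// mulr_ge0.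
have leJ (x : 'rV[R]_p) : `|x| <= c * `|x *m J|.
  rewrite -{1}[x]mulmx1 -(mulmxVp fJ) mulmxA; apply: le_trans (mulmx_norm_le _ _) _.
  by rewrite mulrAC ler_wpM2r// /c lerDl.
pose K := 2 * c * q%:R * `|P| * (`|v| + 1) + q%:R * `|P|.
have K0 : 0 <= K by rewrite addr_ge0// !mulr_ge0 ?addr_ge0// ltW.
(* It suffices to bound [v P] by a fixed multiple of every small [e]; the bound by the inverse of
   [2 * c] serves to absorb an error term below. *)
suff h e : 0 < e -> e <= (2 * c)^-1 -> e <= 1 -> `|v *m P| <= K * e.
  rewrite -normr_le0; apply/ler_addgt0Pr => e e0; rewrite add0r.
  pose e1 := Num.min (Num.min (2 * c)^-1 1) (e / (K + 1)).
  have K1 : 0 < K + 1 by rewrite ltr_wpDl.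
  have e10 : 0 < e1 by rewrite !lt_min ltr01 invr_gt0 divr_gt0// !mulr_gt0.
  apply: le_trans (h e1 e10 _ _) _; rewrite /e1 ?ge_min ?lexx ?orbT//.
  apply: (@le_trans _ _ ((K + 1) * (e / (K + 1)))); last by rewrite mulrCA divff ?gt_eqF// mulr1.
  by rewrite ler_pM ?lerDl// ?ge_min ?lexx ?orbT// ltW.
move=> e0 ec e1.
have /nbhs_normP[d /= d0 hd] := differentiable_approx dphi e0.
pose O := V `&` [set w | `|u - w| < d].
have oO : open O.
  apply: openI => //.
  have -> : [set w | `|u - w| < d] = ball u d by rewrite -ball_normE.
  exact: ball_open.
have [U [oU OU]] := homeo O oO (@subIsetl _ _ _).
have Uu : U (phi u).
  have : (S `&` U) (phi u) by rewrite -OU; exists u => //; split => //=; rewrite subrr normr0.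
  by case.
have dgam : differentiable gamma 0 by apply/derivable1_diffP; case: gder.
have dgamE t : 'd gamma 0 t = t *: v.
  have -> : t = t *: (1 : R) by rewrite /GRing.scale /= mulr1.
  rewrite linearZ /= -deriveE//; case: gder => _ ->.
  by rewrite /GRing.scale/= mulr1.
have gU : \forall t \near (0 : R), U (gamma t).
  have gc : gamma @ (0 : R) --> phi u by rewrite -g0; exact: differentiable_continuous.
  apply: gc.
  exact: open_nbhs_nbhs.
have ga := differentiable_approx dgam e0.
have : \forall t \near (0 : R), [/\ S (gamma t), U (gamma t) &
    `|gamma t - gamma 0 - 'd gamma 0 (t - 0)| <= e * `|t - 0|].
  by near=> t; split; near: t.
move=> /nbhs_normP[r /= r0 hr].
(* For each [e], a single positive time [t] in the neighbourhood is enough. *)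
have [/=|St Ut] := hr (r / 2).
  by rewrite sub0r normrN ger0_norm ?divr_ge0 ?ltW// ltr_pdivrMr// ltr_pMr// ltr1n.
set t := r / 2 in St Ut *; have t0 : 0 < t by rewrite divr_gt0.
rewrite subr0 dgamE g0 (ger0_norm (ltW t0)) => ht.
have : (phi @` O) (gamma t) by rewrite OU.
move=> [w [Vw uw] wE]; have := hd w uw; rewrite -wE in ht *.
rewrite diff_jacobian -/J => hw.
set D := phi w - phi u in ht hw; set x := w - u in hw.
(* Since [c * e <= 1 / 2], the error [c * e * |x|] is absorbed by the left-hand side. *)
have xD : `|x| <= 2 * c * `|D|.
  have h1 : `|x *m J| <= `|D| + e * `|x|.
    rewrite -[x *m J](subKr D); apply: le_trans (ler_normB _ _) _.
    by rewrite lerD2l.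
  have h2 : c * (e * `|x|) <= `|x| / 2.
    rewrite mulrA mulrC ler_wpM2l//.
    by apply: le_trans (ler_wpM2l (ltW c0) ec) _; rewrite invfM mulrCA divff ?gt_eqF// mulr1.
  have h3 := leJ x.
  have h4 : c * `|x *m J| <= c * (`|D| + e * `|x|) by rewrite ler_wpM2l// ltW.
  lra.
have DP : `|D *m P| <= q%:R * (e * `|x|) * `|P|.
  have -> : D *m P = (D - x *m J) *m P.
    by rewrite [RHS]mulmxBl -[x *m J *m P]mulmxA mulmx_coker mulmx0 subr0.
  apply: le_trans (mulmx_norm_le _ _) _; rewrite ler_wpM2r// ler_wpM2l//.
have Dt : `|D| <= t * (`|v| + 1).
  rewrite -[D](subrK (t *: v)); apply: le_trans (ler_normD _ _) _.
  rewrite normrZ (ger0_norm (ltW t0)) mulrDr mulr1 addrC lerD2l.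
  by apply: le_trans ht _; rewrite ler_piMl// ltW.
have : `|t *: (v *m P)| <= t * (K * e).
  rewrite scalemxAl -[t *: v](subKr D) mulmxBl; apply: le_trans (ler_normB _ _) _.
  have h5 : `|(D - t *: v) *m P| <= q%:R * (e * t) * `|P|.
    by apply: le_trans (mulmx_norm_le _ _) _; rewrite ler_wpM2r// ler_wpM2l.
  have h6 : q%:R * (e * `|x|) * `|P| <= q%:R * (e * (2 * c * (t * (`|v| + 1)))) * `|P|.
    rewrite ler_wpM2r// ler_wpM2l// ler_wpM2l ?(ltW e0)//.
    by apply: le_trans xD _; rewrite ler_wpM2l// mulr_ge0// ltW.
  apply: le_trans (lerD (le_trans DP h6) h5) _; rewrite /K.
  by rewrite le_eqVlt; apply/orP; left; apply/eqP; ring.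
by rewrite normrZ (ger0_norm (ltW t0)) ler_pM2l.
Unshelve. all: by end_near. Qed.

Lemma jacobian_tangent_vector (R : realType) p q (S : set 'rV[R]_q)
    (V : set 'rV[R]_p) (phi : 'rV[R]_p -> 'rV[R]_q) u a :
  open V -> V u -> differentiable phi u -> phi @` V `<=` S ->
  tangent_vector S (phi u) (a *m 'J phi u).
Proof.
move=> oV Vu dphi VS; exists (fun t => phi (u + t *: a)); split.
- by rewrite scale0r addr0.
- have /nbhs_normP[d /= d0 hd] : nbhs u V by exact: open_nbhs_nbhs.
  have a1 : 0 < `|a| + 1 by rewrite ltr_wpDl.
  apply/nbhs_normP; exists (d / (`|a| + 1)); rewrite /= ?divr_gt0// => t /=.
  rewrite sub0r normrN ltr_pdivlMr// => ta; apply: VS; exists (u + t *: a) => //.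
  apply: hd => /=; rewrite opprD addNKr normrN normrZ; apply: le_lt_trans ta.
  by rewrite ler_wpM2l// lerDl.
- rewrite -[X in 'J phi X](addr0 u) -[X in u + X](scale0r a).
  by apply: is_derive_line; rewrite scale0r addr0.
Qed.


(** * Anisotropic grids *)

(** The grid has mesh [1 / M ^ e j] in the coordinate [j] and does not depend on [x]. The single
    integer [n] bounds the scales, the indices and the distances, so that countably many pieces
    account for all the constants. *)
Definition grid_piece (R : realType) p (T : Type) (rho : T -> T -> R)
    (psi : 'rV[R]_p -> T) (e : 'I_p -> nat) (n : nat) : set T :=
  [set x | forall M : nat, (n < M)%N -> exists m : 'I_p -> int,
    (forall j, (`|m j| <= n * M ^ e j)%N) /\
    rho x (psi (\row_j ((m j)%:~R / M%:R ^+ e j))) <= n%:R / M%:R].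

Lemma grid_piece_finely_covered (R : realType) p (T : Type) (rho : T -> T -> R)
    (psi : 'rV[R]_p -> T) (e : 'I_p -> nat) (n delta : nat) :
  (forall x y, rho x y = rho y x) ->
  (forall x y z, rho x z <= rho x y + rho y z) ->
  (\sum_j e j <= delta)%N -> finely_covered rho delta (grid_piece rho psi e n).
Proof.
(* The first term counts the grid points, up to the factor [M ^ delta]; the second bounds the
   diameter of a ball of radius [n / M]. *)
move=> rhoC rhoD edelta; exists ((2 * n.+1) ^ p + 2 * n)%N => M CM.
have nM : (n < M)%N.
  by apply: leq_ltn_trans CM; apply: leq_trans (leq_addl _ _); rewrite mul2n -addnn leq_addr.
have M0 : (0 < M)%N by apply: leq_ltn_trans nM.
(* An index is stored as its absolute value and its sign, which leaves at most
   [2 * (n + 1) * M ^ e j] values. *)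
pose T_ (j : 'I_p) : finType := ('I_(n * M ^ e j).+1 * bool)%type.
pose w (i : {dffun forall j, T_ j}) : 'rV[R]_p :=
  \row_j (((-1) ^+ (i j).2 * Posz (i j).1 : int)%:~R / M%:R ^+ e j).
exists {dffun forall j, T_ j}, (fun i => [set x | rho x (psi (w i)) <= n%:R / M%:R]); split.
- move=> x /(_ M nM)[m [mn xm]].
  exists ([ffun j => (inord `|m j|%N, m j < 0)] : {dffun forall j, T_ j}) => /=.
  suff -> : w [ffun j => (inord `|m j|%N, m j < 0)] =
      \row_j ((m j)%:~R / M%:R ^+ e j) by [].
  apply/rowP => j; rewrite !mxE ffunE /= inordK ?ltnS//.
  by rewrite -intEsign.
- rewrite card_dep_ffun foldrE big_image /=.
  apply: (@leq_trans (\prod_(j < p) (2 * n.+1 * M ^ e j))%N).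
    apply: leq_prod => j _; rewrite card_prod card_ord card_bool mulnC -mulnA leq_mul2l /=.
    by rewrite mulSn -add1n leq_add2r expn_gt0 M0.
  rewrite big_split /= prod_nat_const card_ord -expn_sum.
  by apply: leq_mul; rewrite ?leq_addr// leq_pexp2l.
- move=> i x y /= xw yw; apply: le_trans (rhoD x (psi (w i)) y) _.
  rewrite (rhoC _ y); apply: le_trans (lerD xw yw) _.
  rewrite -mulrDl ler_pM2r ?invr_gt0 ?ltr0n// -natrD ler_nat addnn -mul2n.
  by rewrite leq_addl.
Qed.

(** * The degree in terms of the minors of a tangent matrix *)

Section graded_coordinates.
Variables (R : realType) (G : expLieGroup R).
Local Notation q := (lg_dim G).
Variables (V1 V2 : {vspace 'rV[R]_q}) (W : q.-tuple 'rV[R]_q).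

Definition coord_mx : 'M[R]_q := \matrix_(a, j) coord W j (delta_mx 0 a).

Lemma coord_mxE y j : (y *m coord_mx) 0 j = coord W j y.
Proof.
rewrite mxE {2}[y]row_sum_delta linear_sum; apply: eq_bigr => a _.
by rewrite linearZ /= mxE.
Qed.

Variable g : 'rV[R]_q -> 'rV[R]_q -> R.
Hypotheses (V12 : (V1 + V2)%VS = fullv) (hW : graded_basis V1 V2 g W).

Lemma graded_coord_sum y : y = \sum_j coord W j y *: tnth W j.
Proof.
have WE : <<W>>%VS = fullv.
  rewrite -V12 -(span_basis (gb_V1 hW)) -(span_basis (gb_V2 hW)) -span_cat.
  by rewrite cat_take_drop.
rewrite {1}(@coord_span _ _ _ W y) ?WE ?memvf//.
by apply: eq_bigr => j _; rewrite (tnth_nth 0).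
Qed.

Lemma row_free_coord_mx : row_free coord_mx.
Proof.
apply: inj_row_free => v v0; rewrite [v]graded_coord_sum big1// => j _.
by rewrite -coord_mxE v0 mxE scale0r.
Qed.

Lemma weight2_coord0_proj y : (V1 :&: V2)%VS = 0%VS ->
  (forall j, index_weight V1 W j = 2%N -> (y *m coord_mx) 0 j = 0) ->
  daddv_pi V2 V1 y = 0.
Proof.
move=> V120 y0; have yV1 : y \in V1.
  rewrite [y]graded_coord_sum memv_suml// => j _.
  have [WV1|WV1] := boolP (tnth W j \in V1); first exact: memvZ.
  by rewrite -coord_mxE y0 ?scale0r ?mem0v// /index_weight (negPf WV1).
have := daddv_pi_add V120 (_ : y \in V1 + V2)%VS; rewrite V12 memvf => /(_ isT).
by rewrite daddv_pi_id// => /(canRL (addKr _)); rewrite addNr.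
Qed.

Variables (p : nat) (Sigma : set G) (V : set 'rV[R]_p) (phi : 'rV[R]_p -> 'rV[R]_q).
Variable u : 'rV[R]_p.
Hypotheses (oV : open V) (Vu : V u) (dphi : differentiable phi u).
Hypotheses (fJ : row_free ('J phi u)).
Hypothesis homeo : forall O, open O -> O `<=` V ->
  exists U : set 'rV[R]_q, open U /\ phi @` O = (@lg_exp R G @^-1` Sigma) `&` U.

Local Notation Dlog := ('J (log_translate (log_inv (phi u))) (phi u)).

Lemma row_free_Dlog : row_free Dlog.
Proof.
apply: inj_row_free => v v0.
have dv0 : 'd (log_translate (log_inv (phi u))) (phi u) v = 0.
  exact: etrans (diff_jacobian _ _ _) v0.
apply: etrans (esym (log_translate_diffVK (phi u) v)) _.
exact: etrans (congr1 ('d (log_translate (phi u)) 0) dv0) (linear0 _).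
Qed.

(** The value at [phi u] of the field of [X] lies in the row space of the Jacobian, and [Dlog]
    carries it back to [X]. With [lie_tangent_row], this makes the rows of ['J phi u *m Dlog]
    generators of the tangent space. *)
Lemma lie_tangentP X : lie_tangent Sigma (lg_exp (phi u)) X ->
  (X <= 'J phi u *m Dlog)%MS.
Proof.
rewrite /lie_tangent lg_expK => tX.
have := tangent_vector_sub_jacobian oV Vu dphi fJ homeo tX.
rewrite -/(log_translate (phi u)) => h.
have XE := log_translate_diffK (phi u) X.
rewrite -XE; have -> := diff_jacobian (log_translate (log_inv (phi u))) (phi u)
  ('d (log_translate (phi u)) 0 X).
exact: submxMr.
Qed.

Lemma lie_tangent_row i :
  lie_tangent Sigma (lg_exp (phi u)) (row i ('J phi u *m Dlog)).
Proof.
rewrite /lie_tangent lg_expK row_mul rowE.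
have -> : left_inv_field (@lg_exp R G) (@lg_log R G)
    (delta_mx 0 i *m 'J phi u *m Dlog) (phi u) = delta_mx 0 i *m 'J phi u.
  have aE := log_translate_diffVK (phi u) (delta_mx 0 i *m 'J phi u).
  rewrite -[RHS]aE /left_inv_field -/(log_translate (phi u)).
  congr ('d _ 0 _); exact: esym (diff_jacobian _ _ _).
apply: (jacobian_tangent_vector _ oV Vu dphi) => x Vx.
have [U [_ VU]] := homeo oV (@subset_refl _ V).
by move: Vx; rewrite VU => -[].
Qed.

(** The rows are the coordinates in [W] of a basis of the tangent space, moved to the Lie algebra by
    left translation. *)
Local Notation E := ('J phi u *m Dlog *m coord_mx).

Lemma row_free_E : row_free E.
Proof.
apply: inj_row_free => v; rewrite !mulmxA => /eqP.
by rewrite (mulmx_free_eq0 _ row_free_coord_mx) (mulmx_free_eq0 _ row_free_Dlog)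
  (mulmx_free_eq0 _ fJ) => /eqP.
Qed.

(** All tangent p-vectors are proportional: a change of tangent vectors by [X] multiplies every
    minor by the same [\det X]. *)
Lemma wedgeE (v : 'I_p -> 'rV[R]_q) (X : 'M[R]_p) (J : multiindex p q) :
  (forall i, v i = row i (X *m ('J phi u *m Dlog))) ->
  wedge W v J = \det X * \det (colsub (val J) E).
Proof.
move=> vE; rewrite ffunE -det_mulmx -colsub_mul; congr (\det _).
apply/matrixP => i k; rewrite mxE vE -coord_mxE -row_mul [LHS]mxE [RHS]mxE.
by rewrite !mulmxA.
Qed.

(** The p-vector chosen in [degree_at] is a nonzero multiple of the vector of minors of [E], hence
    has the same nonzero coefficients. *)
Lemma degree_at_minor delta (J : multiindex p q) :
  (degree_at V1 W p Sigma (lg_exp (phi u)) <= delta)%N ->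
  colsub (val J) E \in unitmx ->
  (\sum_(i < p) index_weight V1 W (val J i) <= delta)%N.
Proof.
rewrite /degree_at => + uJ; set tau := xget _ _ => tau_le.
have [[J0 tJ0] [v [vt tauE]]] : tangent_pvector W Sigma (lg_exp (phi u)) tau.
  (* The default value of [xget] is ruled out: the wedge of the rows is a tangent p-vector, nonzero
     at the given [J]. *)
  apply: xgetPex.
  pose v i := row i ('J phi u *m Dlog).
  exists (wedge W v); split; last by exists v; split => // i; exact: lie_tangent_row.
  exists J; rewrite (wedgeE (X := 1%:M)); last by move=> i; rewrite mul1mx.
  by rewrite det1 mul1r; rewrite unitmxE unitfE in uJ.
have /submxP[X XE] : (\matrix_i v i <= 'J phi u *m Dlog)%MS.
  by apply/row_subP => i; rewrite rowK; exact: lie_tangentP.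
have vE i : v i = row i (X *m ('J phi u *m Dlog)) by rewrite -XE rowK.
apply: leq_trans tau_le; rewrite /pvector_degree.
apply: (@leq_bigmax_cond _ _
  (fun J : multiindex p q => \sum_(i < p) index_weight V1 W (val J i))%N).
move: tJ0; rewrite tauE !(wedgeE _ vE) !mulf_eq0 !negb_or => /andP[-> _] /=.
by rewrite unitmxE unitfE in uJ.
Qed.

End graded_coordinates.


(** * Grid approximation at points of small degree *)

Lemma floor_dist (R : realType) (x s : R) : 0 < s ->
  `|(Num.floor (x / s))%:~R * s - x| <= s.
Proof.
move=> s0; have /andP[h1 h2] := floor_itv (x / s).
rewrite ler_pdivlMr// in h1; rewrite ltr_pdivrMr// intrD mulrDl mul1r in h2.
by rewrite ler_norml; apply/andP; split; [rewrite lerBrDr addrC; lra | lra].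
Qed.

(* Round the coordinates in the image of f first; the others then only have to
   follow the rounded value of the graph a |-> a *m B. *)
Lemma grid_point (R : realType) p k (u : 'rV[R]_p) (B : 'M[R]_(k, p))
    (f : 'I_k -> 'I_p) (r : R) : colsub f B = 1%:M -> 0 < r ->
  exists (m : 'I_p -> int) (a : 'rV[R]_k), `|a| <= r /\
    `|\row_j ((m j)%:~R * r ^+ (if j \in codom f then 1 else 2)) - u - a *m B|
      <= r ^+ 2.
Proof.
move=> fB r0.
pose a : 'rV[R]_k := \row_i ((Num.floor (u 0 (f i) / r))%:~R * r - u 0 (f i)).
have aB i : (a *m B) 0 (f i) = a 0 i.
  transitivity (colsub f (a *m B) 0 i); first by rewrite [RHS]mxE.
  by rewrite colsub_mul fB mulmx1.
exists (fun j => if j \in codom f then Num.floor (u 0 j / r)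
                 else Num.floor ((u + a *m B) 0 j / r ^+ 2)), a; split.
  by apply: mx_norm_le => [|i j]; [exact: ltW | rewrite mxE floor_dist].
apply: mx_norm_le => [|i j]; first by rewrite exprn_ge0// ltW.
rewrite ord1; set w := \row_j _.
have -> : (w - u - a *m B) 0 j = w 0 j - (u + a *m B) 0 j.
  by rewrite -addrA -opprD [LHS]mxE; congr (_ + _); rewrite [LHS]mxE.
rewrite [w 0 j]mxE; case: ifP => [/codomP[i' ->]|_]; last first.
  by rewrite floor_dist// exprn_gt0.
by rewrite expr1 [(u + _) 0 _]mxE aB [a 0 i']mxE subrKC subrr normr0 exprn_ge0// ltW.
Qed.

Lemma C11_quadratic (R : realType) p q (V : set 'rV[R]_p)
    (phi : 'rV[R]_p -> 'rV[R]_q) u : open V -> V u -> is_C11_on V phi ->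
  exists2 K : R, 0 <= K & \forall w \near u,
    `|phi w - phi u - (w - u) *m 'J phi u| <= K * `|w - u| ^+ 2.
Proof.
move=> oV Vu [dphi /(_ u Vu)[N Nu]] /pinfty_ex_gt0[K K0 hK].
exists (p%:R * K); first by rewrite mulr_ge0// ltW.
apply: quadratic_remainder; first exact: ltW.
have Vn : nbhs u V by exact: open_nbhs_nbhs.
have Nu0 := nbhs_singleton Nu; apply: filterS2 Nu Vn => v Nv Vv; split; first exact: dphi.
have := hK (v, u); rewrite /self_sub /=; apply.
by split.
Qed.

Lemma degree_grid_piece (R : realType) (G : expLieGroup R)
    (V1 V2 : {vspace 'rV[R]_(lg_dim G)}) (hG : two_step_stratified V1 V2)
    (rho : G -> G -> R) (hrho : homogeneous_distance V1 V2 rho)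
    (g : 'rV[R]_(lg_dim G) -> 'rV[R]_(lg_dim G) -> R)
    (W : (lg_dim G).-tuple 'rV[R]_(lg_dim G)) (hW : graded_basis V1 V2 g W)
    (p : nat) (Sigma : set G) (V : set 'rV[R]_p)
    (phi : 'rV[R]_p -> 'rV[R]_(lg_dim G)) u (delta : nat) :
  open V -> V u -> is_C11_on V phi -> row_free ('J phi u) ->
  (forall O, open O -> O `<=` V -> exists U : set 'rV[R]_(lg_dim G),
    open U /\ phi @` O = (@lg_exp R G @^-1` Sigma) `&` U) ->
  (degree_at V1 W p Sigma (lg_exp (phi u)) <= delta)%N ->
  exists (e : {ffun 'I_p -> 'I_3}) (n : nat), (\sum_j e j <= delta)%N /\
    grid_piece rho (@lg_exp R G \o phi) (fun j => e j) n (lg_exp (phi u)).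
Proof.
move=> oV Vu C11 fJ homeo degu.
have V12 := strat_sum hG; have V120 := strat_direct hG.
have [dV _] := C11; have dphi := dV u Vu.
set z := phi u; pose l := log_translate (log_inv z).
pose A : 'M[R]_(p, lg_dim G) := 'J phi u *m 'J l z.
have lz : l z = 0 by exact: log_translateV.
have [K K0 hK] : exists2 K : R, 0 <= K & \forall w \near u,
    `|l (phi w) - (w - u) *m A| <= K * `|w - u| ^+ 2.
  have [K1 K10 hK1] := C11_quadratic oV Vu C11.
  have [K2 K20 hK2] := log_translate_quadratic (log_inv z) z.
  have phic := differentiable_continuous dphi.
  have [K K0 hK] := quadratic_remainder_comp phic K10 K20 hK1 hK2.
  by exists K => //; apply: filterS hK => w; rewrite -/z -/l lz subr0.
have fE := row_free_E (V12) hW fJ.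
have wt12 j : index_weight V1 W j = 1%N \/ index_weight V1 W j = 2%N.
  by rewrite /index_weight; case: ifP; [left | right].
have minors (J : multiindex p (lg_dim G)) :
    colsub (val J) ('J phi u *m 'J l z *m coord_mx W) \in unitmx ->
    (\sum_(i < p) index_weight V1 W (val J i) <= delta)%N.
  exact: (degree_at_minor oV Vu dphi fJ homeo degu).
have [k [B [f [finj fB kp BE]]]] := max_weight_minor fE wt12 minors.
(* Exponents in ['I_3] form a finite type, which keeps the family of pieces countable. *)
pose e : {ffun 'I_p -> 'I_3} := [ffun j => if j \in codom f then inord 1 else inord 2].
have eE j : nat_of_ord (e j) = if j \in codom f then 1%N else 2%N.
  by rewrite ffunE; case: ifP => _; rewrite inordK.
have e_sum : (\sum_j e j <= delta)%N.
  apply: leq_trans kp; rewrite (bigID (mem (codom f)))/=.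
  rewrite (eq_bigr (fun=> 1%N)); last by move=> j jf; rewrite eE jf.
  rewrite [X in (_ + X)%N](eq_bigr (fun=> 2%N)); last by move=> j /negPf jf; rewrite eE jf.
  rewrite !sum_nat_const muln1 card_codom// card_ord leq_add2l mulnC leq_mul2l /=.
  have aux x : (k + x = p -> x <= p - k)%N by move=> <-; rewrite addKn.
  by apply: aux; have := cardC (mem (codom f)); rewrite card_codom// !card_ord.
pose P1 := lin1_mx (daddv_pi V1 V2); pose P2 := lin1_mx (daddv_pi V2 V1).
have P1E y : daddv_pi V1 V2 y = y *m P1 by rewrite mul_rV_lin1.
have P2E y : daddv_pi V2 V1 y = y *m P2 by rewrite mul_rV_lin1.
(* To first order, the directions in the row space of [B] move the point along V1 only. *)
have BA0 (a : 'rV[R]_k) : a *m B *m A *m P2 = 0.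
  rewrite -P2E; apply: (weight2_coord0_proj V12 hW) => // j wj.
  rewrite -mulmxA -mulmxA mxE big1// => i _; rewrite [X in _ * X](_ : _ = 0) ?mulr0//.
  by rewrite -(BE i j wj) !mulmxA.
have [eps eps0 heps] := homogeneous_ball V120 V12 hrho.
have /nbhs_normP[d /= d0 hd] := hK.
pose q : R := (lg_dim G)%:R.
(* [H * r] bounds [|w - u|]: [k * |B|] comes from [|a| <= r], and 1 from [|b| <= r ^ 2 <= r]. *)
pose H : R := k%:R * `|B| + 1.
have H0 : 0 < H by rewrite ltr_wpDl// mulr_ge0.
pose c1 : R := q * (p%:R * H * `|A| + K * H ^+ 2) * `|P1|.
pose c2 : R := q * (K * H ^+ 2 + p%:R * `|A|) * `|P2|.
have KH0 : 0 <= K * H ^+ 2 by rewrite mulr_ge0// exprn_ge0// ltW.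
have pHA0 : 0 <= p%:R * H * `|A| by rewrite mulr_ge0// mulr_ge0// ltW.
have pA0 : 0 <= p%:R * `|A| by rewrite mulr_ge0.
have q0 : 0 <= q by [].
have c10 : 0 <= c1 by rewrite mulr_ge0// mulr_ge0// addr_ge0.
have c20 : 0 <= c2 by rewrite mulr_ge0// mulr_ge0// addr_ge0.
(* [S] dominates all that [n] must exceed: [c1 / eps] and [c2 / eps] for the two components in the
   homogeneous ball, [|u| + H] for the grid indices, and [H / d] for [w] to stay where the quadratic
   estimate holds. *)
pose S : R := c1 / eps + c2 / eps + 1 + (`|u| + H) + H / d.
have t1 : 0 <= c1 / eps by rewrite divr_ge0// ltW.
have t2 : 0 <= c2 / eps by rewrite divr_ge0// ltW.
have t3 : 0 <= `|u| by [].
have t4 : 0 <= H / d by rewrite divr_ge0// ltW.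
pose n := (Num.truncn S).+1.
have Sn : S < n%:R by exact: truncnS_gt.
exists e, n; split => // M nM.
have M0 : 0 < M%:R :> R by rewrite ltr0n (leq_trans _ nM).
pose r : R := M%:R^-1.
have r0 : 0 < r by rewrite invr_gt0.
have r1 : r <= 1 by rewrite invf_le1// ler1n (leq_trans _ nM).
have [m [a [ar br]]] := grid_point u fB r0.
pose w : 'rV[R]_p := \row_j ((m j)%:~R * r ^+ (if j \in codom f then 1 else 2)).
rewrite -/w in br; set b := w - u - a *m B in br.
have wuE : w - u = a *m B + b by rewrite /b subrKC.
have r2r : r ^+ 2 <= r by rewrite expr2 ler_piMl// ltW.
have wuH : `|w - u| <= H * r.
  rewrite wuE /H mulrDl mul1r; apply: le_trans (ler_normD _ _) _.
  apply: lerD; last exact: le_trans br r2r.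
  apply: le_trans (mulmx_norm_le _ _) _.
  by rewrite mulrAC ler_wpM2l// mulr_ge0.
exists m; split.
  move=> j; rewrite eE -(ler_nat R).
  have wj : `|w 0 j| <= n%:R.
    apply: le_trans (mx_entry_norm_le _ _ _) _.
    rewrite -[w](subrK u); apply: le_trans (ler_normD _ _) _.
    have : H * r <= H by rewrite ler_piMr// ltW.
    move: Sn; rewrite /S; lra.
  have -> : (`|m j|%N)%:R = `|w 0 j| * M%:R ^+ (if j \in codom f then 1 else 2) :> R.
    rewrite mxE /r exprVn normrM normfV (ger0_norm (exprn_ge0 _ _))//.
    by rewrite divfK ?expf_neq0 ?gt_eqF// -intr_norm natr_absz.
  by rewrite natrM natrX ler_wpM2r ?exprn_ge0.
have -> : \row_j ((m j)%:~R / M%:R ^+ e j) = w.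
  by apply/rowP => j; rewrite !mxE eE /r exprVn.
rewrite /= -(hd_left_inv hrho (lg_exp z)^-1%g) mulVg.
have -> : ((lg_exp z)^-1 * lg_exp (phi w))%g = lg_exp (l (phi w)).
  by rewrite /l /log_translate lg_logK /log_inv lg_logK.
have F2 : `|l (phi w) - (w - u) *m A| <= K * H ^+ 2 * r ^+ 2.
  have Hr : H * r < d.
    rewrite /r ltr_pdivrMr// mulrC -ltr_pdivrMr//.
    apply: (@lt_trans _ _ n%:R); last by rewrite ltr_nat.
    by move: Sn; rewrite /S; lra.
  apply: le_trans (hd w _) _; first by rewrite /= distrC (le_lt_trans wuH).
  rewrite -mulrA ler_wpM2l// -exprMn lerXn2r ?nnegrE// mulr_ge0 ?ltW//.
have F1 : `|l (phi w)| <= (p%:R * H * `|A| + K * H ^+ 2) * r.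
  rewrite -[l _](subrK ((w - u) *m A)) addrC; apply: le_trans (ler_normD _ _) _.
  rewrite mulrDl; apply: lerD.
    apply: le_trans (mulmx_norm_le _ _) _.
    by rewrite [leRHS]mulrAC ler_wpM2r// -mulrA ler_wpM2l.
  by apply: le_trans F2 _; rewrite ler_wpM2l// mulr_ge0// exprn_ge0// ltW.
have n1 : 1 <= n%:R :> R by rewrite ler1n.
rewrite /r in r0 *; rewrite -[M%:R^-1]/r.
(* The radius is [n * r]. The components are at most [c1 * r] and [c2 * r ^ 2], while
   [c1 <= eps * n] and [c2 <= eps * n <= eps * n ^ 2]. *)
apply: heps; first by rewrite mulr_gt0// ltr0n.
- rewrite P1E; apply: le_trans (mulmx_norm_le _ _) _.
  apply: (@le_trans _ _ (c1 * r)).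
    by rewrite /c1 [leRHS]mulrAC ler_wpM2r// -[leRHS]mulrA ler_wpM2l.
  rewrite mulrA ler_wpM2r ?(ltW r0)// mulrC -ler_pdivrMr//.
  by move: Sn; rewrite /S; lra.
- rewrite P2E.
  (* The part [a *m B] of the linear term is killed by [P2]; the quadratic remainder and [b *m A]
     are left, both of order [r ^ 2]. *)
  have -> : l (phi w) *m P2 = (l (phi w) - (w - u) *m A + b *m A) *m P2.
    by rewrite wuE mulmxDl opprD addrA subrK mulmxBl BA0 subr0.
  apply: le_trans (mulmx_norm_le _ _) _.
  apply: (@le_trans _ _ (c2 * r ^+ 2)).
    rewrite /c2 [leRHS]mulrAC ler_wpM2r// -[leRHS]mulrA ler_wpM2l//.
    apply: le_trans (ler_normD _ _) _; rewrite mulrDl lerD//.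
    apply: le_trans (mulmx_norm_le _ _) _.
    by rewrite [leRHS]mulrAC ler_wpM2r// ler_wpM2l.
  rewrite exprMn [leRHS]mulrA ler_wpM2r ?exprn_ge0 ?(ltW r0)// mulrC -ler_pdivrMr//.
  apply: (@le_trans _ _ n%:R); first by move: Sn; rewrite /S; lra.
  by rewrite expr2 ler_peMl.
Qed.


(** * Countable decomposition of the set of points of small degree *)

(** With [2 / (n + 1) < d], any closed ball of radius [1 / (n + 1)] that contains [z] lies in the
    ball of radius [d] about [z]; its centre can be taken rational. *)
Lemma rational_ball (R : realType) q (z : 'rV[R]_q) (U : set 'rV[R]_q) :
  nbhs z U -> exists (c : 'rV[rat]_q) (n : nat),
    `|z - map_mx ratr c| <= n.+1%:R^-1 /\
    forall z', `|z' - map_mx ratr c| <= n.+1%:R^-1 -> U z'.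
Proof.
move=> /nbhs_normP[d /= d0 hd]; pose n := Num.truncn (2 / d).
have n0 : 0 < n.+1%:R^-1 :> R by rewrite invr_gt0 ltr0n.
have nd : n.+1%:R^-1 + n.+1%:R^-1 < d.
  have -> : n.+1%:R^-1 + n.+1%:R^-1 = 2 / n.+1%:R :> R by rewrite mulr_natl mulr2n.
  by rewrite ltr_pdivrMr ?ltr0n// mulrC -ltr_pdivrMr// truncnS_gt.
have [c cP] : {c : 'I_q -> rat & forall j, `|z 0 j - ratr (c j)| <= n.+1%:R^-1}.
  apply: (@choice _ _ (fun j y => `|z 0 j - ratr y| <= n.+1%:R^-1)) => j.
  have [|y] := @rat_in_itvoo _ (z 0 j - n.+1%:R^-1) (z 0 j + n.+1%:R^-1).
    by rewrite ltrD2l gtrN.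
  rewrite in_itv /= => /andP[y1 y2]; exists y.
  by rewrite distrC ler_distl (ltW y1) (ltW y2).
exists (\row_j c j), n.
have zc : `|z - map_mx ratr (\row_j c j)| <= n.+1%:R^-1.
  by apply: mx_norm_le => [|i j]; [exact: ltW | rewrite ord1 !mxE].
split => // z' z'c; apply: hd => /=; apply: le_lt_trans nd.
rewrite -(subrK (map_mx ratr (\row_j c j)) z) -addrA.
by apply: le_trans (ler_normD _ _) _; rewrite lerD// distrC.
Qed.

Theorem corollary1p3 (R : realType) (G : expLieGroup R)
    (V1 V2 : {vspace 'rV[R]_(lg_dim G)}) (hG : two_step_stratified V1 V2)
    (rho : G -> G -> R) (hrho : homogeneous_distance V1 V2 rho)
    (g : 'rV[R]_(lg_dim G) -> 'rV[R]_(lg_dim G) -> R)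
    (hg : graded_metric V1 V2 g)
    (W : (lg_dim G).-tuple 'rV[R]_(lg_dim G)) (hW : graded_basis V1 V2 g W)
    (p : nat) (Sigma : set G) (hSigma : C11_submanifold p Sigma)
    (d : nat) (hd : has_degree V1 W p Sigma d)
    (delta : nat) (hdelta : (0 < delta)%N) :
  let Z := [set x | Sigma x /\ (degree_at V1 W p Sigma x <= delta)%N] in
  countably_finite (hausdorff_measure rho delta%:R) Z /\
  (hausdorff_dim rho Z <= (delta%:R)%:E)%E.
Proof.
move=> Z.
pose q := lg_dim G.
pose S : set 'rV[R]_q := @lg_exp R G @^-1` Sigma.
pose is_chart (cs : 'rV[rat]_q * nat) (phi : 'rV[R]_p -> 'rV[R]_q) :=
  exists V : set 'rV[R]_p, [/\ open V, is_C11_on V phi,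
    (forall u, V u -> row_free ('J phi u)),
    (forall O, open O -> O `<=` V ->
      exists U : set 'rV[R]_q, open U /\ phi @` O = S `&` U) &
    forall z, S z -> `|z - map_mx ratr cs.1| <= cs.2.+1%:R^-1 -> (phi @` V) z].
(* The charts are indexed by rational balls of R^q: Lindelof's property. *)
have [chart chartP] :
    {chart & forall cs, (exists phi, is_chart cs phi) -> is_chart cs (chart cs)}.
  apply: (@choice _ _ (fun cs phi' => (exists phi, is_chart cs phi) -> is_chart cs phi')).
  move=> cs; have [[phi cphi]|nphi] := pselect (exists phi, is_chart cs phi).
    by exists phi.
  by exists (fun=> 0) => /nphi.
(* An index consists of a rational ball, an exponent for each coordinate and the integer constant of
   the piece. *)
pose index : countType := ('rV[rat]_q * nat * ({ffun 'I_p -> 'I_3} * nat))%type.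
pose piece (t : index) : set G :=
  if (\sum_j t.2.1 j <= delta)%N then
    grid_piece rho (@lg_exp R G \o chart t.1) (fun j => t.2.1 j) t.2.2
  else set0.
have cov0 : finely_covered rho delta set0.
  by exists 0%N => M _; exists void, (fun=> set0); split => //; rewrite card_void.
have covP t : finely_covered rho delta (piece t).
  rewrite /piece; case: ifP => // et.
  by apply: grid_piece_finely_covered et; [exact: hd_sym hrho | exact: hd_triangle hrho].
have Zpiece x : Z x -> exists t, piece t x.
  move=> [Sx degx]; rewrite -(lg_logK x) in Sx degx *; set z := lg_log x in Sx degx *.
  have [V [phi [oV Vz C11 fphi [_ homeo]]]] := hSigma z Sx.
  have [U [oU VU]] := homeo V oV (@subset_refl _ V).
  have Uz : nbhs z U.
    by apply: open_nbhs_nbhs; split => //; move: Vz; rewrite VU => -[].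
  have [c [n [zc cU]]] := rational_ball Uz.
  (* The chart fixed for this ball may differ from [phi], whose only role is to show that one
     exists; it still covers [z], at a parameter [u] of its own. *)
  have [|W' [oW' C11' fphi' homeo' covers]] := chartP (c, n).
    exists phi, V; split => // z' Sz' z'c; rewrite VU; split => //; exact: cU.
  have [u Wu uz] := covers z Sx zc.
  rewrite -uz in degx *.
  have [e [k [ek xk]]] := degree_grid_piece hG hrho hW oW' Wu C11' (fphi' u Wu) homeo' degx.
  by exists ((c, n), (e, k)); rewrite /piece /= ek.
(* A grid piece may contain points outside [Z], hence the intersection; integers that code no index
   give the empty set. *)
pose A (k : nat) : set G := Z `&` (if unpickle k is Some t then piece t else set0).
have -> : Z = \bigcup_k A k.
  apply/seteqP; split => [x Zx|x [k _ []]//].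
  have [t tx] := Zpiece x Zx.
  by exists (pickle t) => //; split => //; rewrite pickleK.
apply: finely_covered_bigcup => [|k]; first exact: hd_ge0 hrho.
apply: finely_coveredS (@subIsetr _ _ _) _.
by case: unpickle.
Qed.
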